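(* Let $p$ be a prime, $m\ge1$, $y\in F$, and $$0<\rho\le\begin{cases}\frac{p-2}{p}(1-p^{-m}), & p>2,\\ \frac{1-2^{-m}}{4}, & p=2.\end{cases}$$ Then there exists a solution $u$ of the mean field equation $Du+\rho e^u=\rho\delta_y$ on $F$ (the Tate curve $\mathbb{Q}_p^\times/p^{m\mathbb{Z}}$).
   Context: $F=\bigcup_{k=0}^{m-1}p^k\mathbb{Z}_p^\times$ is a fundamental domain for $\mathbb{Q}_p^\times/p^{m\mathbb{Z}}$, equipped with the measure $d\mu=\frac{dx}{|x|_p}$, where $dx$ is the additive Haar measure on $\mathbb{Q}_p$ with $\int_{\mathbb{Z}_p}dx=1$ and $|\cdot|_p$ is the $p$-adic absolute value. $D$ is the operator $D\phi(x)=|x|_p\int_F\frac{\phi(z)-\phi(x)}{|z-x|_p^2}dz$ ($x\in F$). A solution of $Du+\rho e^u=\rho\delta_y$ means a function $u:F\setminus\{y\}\to\mathbb{R}$, locally constant on $F\setminus\{y\}$, with $u,e^u\in L^1(F,\mu)$, such that for every locally constant function $\phi$ on $F$, $$\int_F u\,(D\phi)\,d\mu+\rho\int_F e^u\phi\,d\mu=\rho\,\phi(y).$$ *)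

(* Defs.v *)
From HB Require Import structures.
From mathcomp Require Import all_boot all_order all_algebra.
From mathcomp Require Import all_classical all_reals all_analysis.
From mathcomp Require Import zify measurable_realfun.

Set Implicit Arguments.
Unset Strict Implicit.
Unset Printing Implicit Defensive.

Import Order.TTheory GRing.Theory Num.Theory.

Local Open Scope classical_set_scope.
Local Open Scope ring_scope.

(* Z_p as the inverse limit of the rings Z/p^n: a p-adic integer is the
   coherent sequence of its canonical residues a n, with 0 <= a n < p^n
   (coherence forces the bounds, since a n is a remainder modulo p^n). *)
Definition coherent (p : nat) (a : nat -> int) : bool :=
  `[< forall n, a n = (a n.+1 %% (p ^ n)%N)%Z >].

Record padic_int (p : nat) (p_pr : prime p) : Type := PadicInt {
  residue : nat -> int ;
  residue_coherent : coherent p residue }.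

HB.instance Definition _ p (p_pr : prime p) := [isSub for @residue p p_pr].
HB.instance Definition _ p (p_pr : prime p) := [Choice of padic_int p_pr by <:].

Section pint_ring.
Variables (p : nat) (p_pr : prime p).
Local Notation padic_int := (padic_int p_pr).

Lemma modz_expS (a : int) n : ((a %% (p ^ n.+1)%N)%Z = a %[mod (p ^ n)%N])%Z.
Proof.
apply/eqP; rewrite eqz_mod_dvd {2}(divz_eq a (p ^ n.+1)%N) opprD addrCA subrr.
by rewrite addr0 expnS PoszM -mulNr mulrA dvdz_mull.
Qed.

Lemma residue_mod (x : padic_int) n : (residue x n %% (p ^ n)%N)%Z = residue x n.
Proof. by have /asboolP/(_ n) -> := residue_coherent x; rewrite modz_mod. Qed.

Lemma residueS (x : padic_int) n :
  (residue x n.+1 = residue x n %[mod (p ^ n)%N])%Z.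
Proof. by have /asboolP/(_ n) -> := residue_coherent x; rewrite modz_mod. Qed.

Lemma pint_P (x y : padic_int) : residue x =1 residue y -> x = y.
Proof. by move=> h; apply/val_inj/funext. Qed.

Fact mk_pint_subproof (a : nat -> int) :
  (forall n, (a n.+1 = a n %[mod (p ^ n)%N])%Z) ->
  coherent p (fun n => (a n %% (p ^ n)%N)%Z).
Proof. by move=> h; apply/asboolP => n; rewrite modz_expS h. Qed.

Definition mk_pint a ha : padic_int := PadicInt p_pr (@mk_pint_subproof a ha).

Fact pint_const_subproof (c : int) n : (c = c %[mod (p ^ n)%N])%Z.
Proof. by []. Qed.

Fact pint_add_subproof (x y : padic_int) n :
  (residue x n.+1 + residue y n.+1 = residue x n + residue y n
     %[mod (p ^ n)%N])%Z.
Proof. by rewrite -modzDm !residueS modzDm. Qed.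

Fact pint_opp_subproof (x : padic_int) n :
  (- residue x n.+1 = - residue x n %[mod (p ^ n)%N])%Z.
Proof. by rewrite -modzNm residueS modzNm. Qed.

Fact pint_mul_subproof (x y : padic_int) n :
  (residue x n.+1 * residue y n.+1 = residue x n * residue y n
     %[mod (p ^ n)%N])%Z.
Proof. by rewrite -modzMm !residueS modzMm. Qed.

Definition pint_zero : padic_int := mk_pint (pint_const_subproof 0).
Definition pint_one : padic_int := mk_pint (pint_const_subproof 1).
Definition pint_add x y : padic_int := mk_pint (pint_add_subproof x y).
Definition pint_opp x : padic_int := mk_pint (pint_opp_subproof x).
Definition pint_mul x y : padic_int := mk_pint (pint_mul_subproof x y).

Fact pint_addA : associative pint_add.
Proof. by move=> x y z; apply: pint_P => n /=; rewrite modzDmr modzDml addrA. Qed.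
Fact pint_addC : commutative pint_add.
Proof. by move=> x y; apply: pint_P => n /=; rewrite addrC. Qed.
Fact pint_add0 : left_id pint_zero pint_add.
Proof. by move=> x; apply: pint_P => n /=; rewrite modzDml add0r residue_mod. Qed.
Fact pint_addN : left_inverse pint_zero pint_opp pint_add.
Proof. by move=> x; apply: pint_P => n /=; rewrite modzDml addNr. Qed.

HB.instance Definition _ :=
  GRing.isZmodule.Build padic_int pint_addA pint_addC pint_add0 pint_addN.

Fact pint_mulA : associative pint_mul.
Proof. by move=> x y z; apply: pint_P => n /=; rewrite modzMmr modzMml mulrA. Qed.
Fact pint_mulC : commutative pint_mul.
Proof. by move=> x y; apply: pint_P => n /=; rewrite mulrC. Qed.
Fact pint_mul1 : left_id pint_one pint_mul.
Proof. by move=> x; apply: pint_P => n /=; rewrite modzMml mul1r residue_mod. Qed.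
Fact pint_mulDl : left_distributive pint_mul pint_add.
Proof.
by move=> x y z; apply: pint_P => n /=; rewrite modzMml modzDm mulrDl.
Qed.
Fact pint_one_neq0 : pint_one != 0.
Proof.
apply/eqP => /(congr1 (fun x : padic_int => residue x 1)) /=.
by rewrite expn1 mod0z modz_small// ltz_nat prime_gt1.
Qed.

HB.instance Definition _ := GRing.Zmodule_isComNzRing.Build padic_int
  pint_mulA pint_mulC pint_mul1 pint_mulDl pint_one_neq0.

Definition pint_unit : {pred padic_int} := fun x => `[< exists y : padic_int, y * x = 1 >].

Definition pint_inv (x : padic_int) : padic_int :=
  if pselect (exists y : padic_int, y * x = 1) is left h then projT1 (cid h) else x.

Fact pint_mulVx : {in pint_unit, left_inverse 1 pint_inv *%R}.
Proof.
move=> x /asboolP h; rewrite /pint_inv; case: pselect => // h'.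
by case: cid.
Qed.
Fact pint_unitPl (x y : padic_int) : y * x = 1 -> pint_unit x.
Proof. by move=> h; apply/asboolP; exists y. Qed.
Fact pint_invr_out : {in [predC pint_unit], pint_inv =1 id}.
Proof.
move=> x /negP h; rewrite /pint_inv; case: pselect => // h'.
by exfalso; apply: h; apply/asboolP.
Qed.

HB.instance Definition _ :=
  GRing.ComNzRing_hasMulInverse.Build padic_int pint_mulVx pint_unitPl pint_invr_out.

Lemma residueD (x y : padic_int) n :
  residue (x + y) n = ((residue x n + residue y n) %% (p ^ n)%N)%Z.
Proof. by []. Qed.

Lemma residueM (x y : padic_int) n :
  residue (x * y) n = ((residue x n * residue y n) %% (p ^ n)%N)%Z.
Proof. by []. Qed.

Lemma residue_le (x : padic_int) k n : (k <= n)%N ->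
  residue x k = (residue x n %% (p ^ k)%N)%Z.
Proof.
move=> /subnK <-; elim: (n - k)%N => [|j IH]; first by rewrite residue_mod.
rewrite IH; have /asboolP/(_ (j + k)%N) -> := residue_coherent x.
apply/eqP; rewrite addSn eq_sym eqz_mod_dvd.
rewrite {1}(divz_eq (residue x (j + k).+1) (p ^ (j + k))%N) addrK.
by rewrite expnD PoszM mulrA dvdz_mull.
Qed.

Lemma residue_neq0 (x : padic_int) : x != 0 -> exists n, residue x n.+1 != 0.
Proof.
move=> /eqP x0; apply: contrapT => h; apply: x0; apply: pint_P => n.
rewrite /= mod0z; have /asboolP/(_ n) -> := residue_coherent x.
rewrite [residue x n.+1](_ : _ = 0) ?mod0z//; apply/eqP/negP => /negP h'.
by apply: h; exists n.
Qed.

(* The p-adic valuation on Z_p, with junk value 0 at 0: the least n such that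
   x does not vanish modulo p^(n+1). *)
Definition pint_val (x : padic_int) : nat :=
  if pselect (exists n, residue x n.+1 != 0) is left h then ex_minn h else 0.

Lemma pint_valP (x : padic_int) : x != 0 ->
  residue x (pint_val x) = 0 /\ residue x (pint_val x).+1 != 0.
Proof.
move=> /residue_neq0 h; rewrite /pint_val; case: pselect => // h'.
case: ex_minnP => -[|n] hn hmin; split=> //.
  by rewrite -residue_mod expn0 modz1.
by apply/eqP/negP => /negP /hmin; rewrite ltnn.
Qed.

Lemma pint_val_eq (x : padic_int) k :
  residue x k = 0 -> residue x k.+1 != 0 -> pint_val x = k.
Proof.
move=> hk hk1; rewrite /pint_val; case: pselect => [h|[]]; last by exists k.
case: ex_minnP => n hn hmin; apply/eqP; rewrite eqn_leq hmin// leqNgt.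
apply/negP => ltnk; move/negP: hn; apply.
by rewrite (residue_le x ltnk) hk mod0z.
Qed.

Lemma pint_mul_val (x y : padic_int) : x != 0 -> y != 0 ->
  residue (x * y) (pint_val x + pint_val y) = 0 /\
  residue (x * y) (pint_val x + pint_val y).+1 != 0.
Proof.
move=> /pint_valP; set a := pint_val x; move=> [x0 x1].
move=> /pint_valP; set b := pint_val y; move=> [y0 y1].
have p_gt0 := prime_gt0 p_pr.
pose N := (a + b).+1; pose X := residue x N; pose Y := residue y N.
have xk k : (k <= N)%N -> residue x k = (X %% (p ^ k)%N)%Z.
  by exact: residue_le.
have yk k : (k <= N)%N -> residue y k = (Y %% (p ^ k)%N)%Z.
  by exact: residue_le.
have aN : (a <= N)%N by rewrite leqW// leq_addr.
have bN : (b <= N)%N by rewrite leqW// leq_addl.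
have a1N : (a.+1 <= N)%N by rewrite ltnS leq_addr.
have b1N : (b.+1 <= N)%N by rewrite ltnS leq_addl.
move: x0 x1 y0 y1; rewrite !xk// !yk// => /dvdz_mod0P/dvdzP[X' XE] X1.
move=> /dvdz_mod0P/dvdzP[Y' YE] Y1.
have pX : ~~ (p %| X')%Z.
  apply: contra X1 => /dvdzP[q qE]; apply/eqP/dvdz_mod0P.
  by rewrite XE qE expnS PoszM -mulrA dvdz_mull.
have pY : ~~ (p %| Y')%Z.
  apply: contra Y1 => /dvdzP[q qE]; apply/eqP/dvdz_mod0P.
  by rewrite YE qE expnS PoszM -mulrA dvdz_mull.
have XYE : X * Y = X' * Y' * (p ^ (a + b))%N.
  by rewrite XE YE expnD PoszM mulrACA.
have r1 : residue (x * y) N = ((X * Y) %% (p ^ N)%N)%Z by rewrite residueM.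
split.
  rewrite (residue_le (x * y) (leqnSn (a + b))) r1 modz_expS.
  by rewrite XYE; apply/dvdz_mod0P; rewrite dvdz_mull.
rewrite r1; apply/eqP => /dvdz_mod0P; rewrite XYE expnS PoszM.
rewrite dvdz_mul2r; last first.
  by rewrite eqz_nat expn_eq0 negb_and -lt0n p_gt0.
rewrite dvdzE abszM Euclid_dvdM//; apply/negP.
by move: pX pY; rewrite !dvdzE => /negbTE -> /negbTE ->.
Qed.

Lemma pint_mulf_eq0 : GRing.integral_domain_axiom padic_int.
Proof.
move=> x y xy0; apply: contrapT => /negP; rewrite negb_or => /andP[x0 y0].
have [_ /eqP] := pint_mul_val x0 y0; apply.
by rewrite xy0 /= mod0z.
Qed.

HB.instance Definition _ := GRing.ComUnitRing_isIntegral.Build padic_int pint_mulf_eq0.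

Lemma pint_valM (x y : padic_int) : x != 0 -> y != 0 ->
  pint_val (x * y) = (pint_val x + pint_val y)%N.
Proof. by move=> x0 y0; have [] := pint_mul_val x0 y0; exact: pint_val_eq. Qed.

Lemma pint_valD (x w : padic_int) : x != 0 ->
  (w != 0 -> (pint_val x < pint_val w)%N) ->
  x + w != 0 /\ pint_val (x + w) = pint_val x.
Proof.
move=> x0; have [->|w0] := eqVneq w 0; first by rewrite addr0.
move=> /(_ isT) xw; have [h0 h1] := pint_valP x0; have [w1 _] := pint_valP w0.
have wk : residue w (pint_val x).+1 = 0 by rewrite (residue_le w xw) w1 mod0z.
have r1 : residue (x + w) (pint_val x).+1 != 0.
  by rewrite residueD wk addr0 residue_mod.
have r0 : residue (x + w) (pint_val x) = 0.
  by rewrite residueD h0 add0r (residue_le w (ltnW xw)) w1 !mod0z.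
split; last exact: pint_val_eq.
by apply: contra r1 => /eqP ->; rewrite /= mod0z.
Qed.

End pint_ring.

Definition padic (p : nat) (p_pr : prime p) := {fraction padic_int p_pr}.

HB.instance Definition _ p (p_pr : prime p) := GRing.Field.on (padic p_pr).
HB.instance Definition _ p (p_pr : prime p) := isPointed.Build (padic p_pr) 0.

Section padic_abs.
Variables (p : nat) (p_pr : prime p).
Local Notation Zp := (padic_int p_pr).
Local Notation Qp := (padic p_pr).
Implicit Types (x y z : Qp).

Definition padic_of_int (a : Zp) : Qp := FracField.tofrac a.

(* v(n / d) = v(n) - v(d) on the chosen representative n / d, with a junk value
   at 0; see padic_val_frac for the independence of the representative. *)
Definition padic_val x : int :=
  (pint_val (val (repr x)).1)%:Z - (pint_val (val (repr x)).2)%:Z.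

Definition padic_abs (R : numFieldType) x : R :=
  if x == 0 then 0 else p%:R ^ (- padic_val x).

Lemma padic_abs0 (R : numFieldType) : padic_abs R 0 = 0.
Proof. by rewrite /padic_abs eqxx. Qed.

Lemma padic_abs_gt0 (R : numFieldType) x : x != 0 -> 0 < padic_abs R x.
Proof. by rewrite /padic_abs => /negbTE ->; rewrite exprz_gt0// ltr0n prime_gt0. Qed.

Lemma padic_abs_ge0 (R : numFieldType) x : 0 <= padic_abs R x.
Proof. by have [->|/(padic_abs_gt0 R)/ltW//] := eqVneq x 0; rewrite padic_abs0. Qed.

Lemma padic_of_int_eq0 (a : Zp) : (padic_of_int a == 0) = (a == 0).
Proof. exact: tofrac_eq0. Qed.

Lemma padicE x :
  x = padic_of_int (val (repr x)).1 / padic_of_int (val (repr x)).2.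
Proof.
have piE (r : {ratio Zp}) : (\pi_Qp r : Qp)%qT * padic_of_int (val r).2
    = padic_of_int (val r).1.
  have d0 : (val r).2 != 0 by exact: denom_ratioP.
  rewrite /padic_of_int; unlock FracField.tofrac.
  rewrite -[LHS]FracField.pi_mul; apply/eqP; rewrite FracField.equivf_def.
  rewrite /FracField.mulf !numden_Ratio ?oner_eq0 ?mulr1//.
  by rewrite mulrC.
apply/(canRL (mulfK _)); last by rewrite -{1}[x]reprK piE.
by rewrite padic_of_int_eq0; exact: denom_ratioP.
Qed.

Lemma padic_val_frac (a b : Zp) : a != 0 -> b != 0 ->
  padic_val (padic_of_int a / padic_of_int b)
    = (pint_val a)%:Z - (pint_val b)%:Z.
Proof.
move=> a0 b0; rewrite /padic_val.
have := padicE (padic_of_int a / padic_of_int b).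
have : (val (repr (padic_of_int a / padic_of_int b))).2 != 0.
  exact: denom_ratioP.
move: (val (repr _)) => [n d]/= d0 /eqP.
rewrite eqr_div ?padic_of_int_eq0// /padic_of_int -!tofracM tofrac_eq => /eqP nE.
have n0 : n != 0.
  apply: contra_neq a0 => n0; move/eqP: nE.
  by rewrite n0 mul0r mulf_eq0 (negbTE d0) orbF => /eqP.
have := congr1 (@pint_val p p_pr) nE; rewrite !pint_valM//; lia.
Qed.

Lemma padic_abs_loc_cst (R S : realFieldType) x z :
  padic_abs R (z - x) < padic_abs R x -> padic_abs S z = padic_abs S x.
Proof.
have p1 : 1 < p%:R :> R by rewrite ltr1n prime_gt1.
rewrite -{2}(subrK x z); move: (z - x) => w {z}.
have [->|x0] := eqVneq x 0.
  by rewrite padic_abs0 => h; have := le_lt_trans (padic_abs_ge0 R w) h; rewrite ltxx.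
rewrite /padic_abs (negbTE x0).
have [->|w0] := eqVneq w 0; first by rewrite add0r (negbTE x0).
rewrite (ltr_eXz2l p1) ltrN2.
rewrite (padicE x) (padicE w) in x0 w0 *.
have : (val (repr x)).2 != 0 by exact: denom_ratioP.
have : (val (repr w)).2 != 0 by exact: denom_ratioP.
move: (val (repr x)) (val (repr w)) x0 w0 => [a b] [c d] /= + + d0 b0.
rewrite !mulf_eq0 !invr_eq0 !padic_of_int_eq0 (negbTE d0) (negbTE b0) !orbF.
move=> a0 c0.
rewrite addrC addf_div ?padic_of_int_eq0// /padic_of_int.
rewrite -!tofracM -tofracD -!/(padic_of_int _) => h; rewrite !padic_val_frac// in h.
have ad0 : a * d != 0 by rewrite mulf_neq0.
have cb0 : c * b != 0 by rewrite mulf_neq0.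
have bd0 : b * d != 0 by rewrite mulf_neq0.
have [|s0 sE] := @pint_valD p p_pr (a * d) (c * b) ad0.
  by move=> _; rewrite !pint_valM//; lia.
rewrite mulf_eq0 invr_eq0 !padic_of_int_eq0 (negbTE s0) (negbTE bd0)/=.
rewrite !padic_val_frac// sE !pint_valM//; congr (_ ^ _); lia.
Qed.

(* The p-adic topology; radii are taken in rat so that the topology does not
   depend on the field in which |.|_p takes its values. *)
Definition padic_open : set_system Qp := [set U | forall x, U x ->
  exists2 e : rat, 0 < e & [set z | padic_abs rat (z - x) < e] `<=` U].

Fact padic_openT : padic_open setT.
Proof. by move=> x _; exists 1. Qed.

Fact padic_openI : setI_closed padic_open.
Proof.
move=> U V oU oV x [/oU[e e0 eU] /oV[f f0 fV]].
exists (Order.min e f); first by rewrite lt_min e0.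
by move=> z/=; rewrite lt_min => /andP[/eU ? /fV ?].
Qed.

Fact padic_open_bigU (I : Type) (f : I -> set Qp) :
  (forall i, padic_open (f i)) -> padic_open (\bigcup_i f i).
Proof.
move=> of_ x [i _ /of_[e e0 eU]]; exists e => // z /eU ?; by exists i.
Qed.

HB.instance Definition _ := isOpenTopological.Build Qp
  padic_openT padic_openI padic_open_bigU.

Definition padic_borel : set_system Qp := <<s [set U : set Qp | open U] >>.

Fact padic_borel0 : padic_borel set0.
Proof. exact: sigma_algebra0. Qed.
Fact padic_borelC (A : set Qp) : padic_borel A -> padic_borel (~` A).
Proof. by move=> ?; rewrite -setTD; exact: sigma_algebraCD. Qed.
Fact padic_borelU (A : (set Qp)^nat) :
  (forall i, padic_borel (A i)) -> padic_borel (\bigcup_i A i).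
Proof. exact: sigma_algebra_bigcup. Qed.

HB.instance Definition _ := @isMeasurable.Build default_measure_display Qp
  padic_borel padic_borel0 padic_borelC padic_borelU.

Lemma padic_openE : @open Qp = padic_open.
Proof. by []. Qed.

Lemma measurable_padic_open (U : set Qp) : padic_open U -> measurable U.
Proof. by move=> oU; apply: sub_sigma_algebra. Qed.

Lemma measurable_padic_set1_0 : measurable [set (0 : Qp)].
Proof.
rewrite -[X in measurable X]setCK; apply: measurableC.
apply: measurable_padic_open => x /= /eqP x0.
exists (padic_abs rat x).
  by rewrite padic_abs_gt0.
move=> z /= zx z0; move: (padic_abs_loc_cst rat zx); rewrite z0 padic_abs0.
by move=> /eqP; rewrite lt_eqF// padic_abs_gt0.
Qed.

Lemma measurable_padic_absV (R : realType) :
  measurable_fun setT (fun x => (padic_abs R x)^-1).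
Proof.
pose f x := (padic_abs R x)^-1.
move=> _ B _; rewrite setTI -(setUIDK (f @^-1` B) [set 0]).
apply: measurableU; last first.
  apply: measurable_padic_open => x [Bx /eqP x0].
  exists (padic_abs rat x); first by rewrite padic_abs_gt0.
  move=> z /= zx; split; first by rewrite /= /f (padic_abs_loc_cst R zx).
  move=> z0; move: (padic_abs_loc_cst rat zx); rewrite z0 padic_abs0.
  by move=> /eqP; rewrite lt_eqF// padic_abs_gt0.
have [B0|B0] := pselect (B (f 0)).
  rewrite (_ : _ `&` _ = [set 0]); first exact: measurable_padic_set1_0.
  by apply/seteqP; split=> [x []//|x ->].
rewrite (_ : _ `&` _ = set0)//; apply/seteqP; split=> // x [+ x0].
by rewrite x0.
Qed.

End padic_abs.

Definition padic_integers p (p_pr : prime p) : set (padic p_pr) :=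
  range (@padic_of_int p p_pr).

Definition padic_units p (p_pr : prime p) : set (padic p_pr) :=
  [set padic_of_int u | u in [set u : padic_int p_pr | u \is a GRing.unit]].

Arguments padic_integers p p_pr : clear implicits.
Arguments padic_units p p_pr : clear implicits.

(* The fundamental domain F of Q_p^x / p^(mZ). *)
Definition fund_domain p (p_pr : prime p) (m : nat) : set (padic p_pr) :=
  \bigcup_(k in `I_m) [set p%:R ^+ k * u | u in padic_units p p_pr].

Arguments fund_domain p p_pr m : clear implicits.

Section Haar.
Variables (p : nat) (p_pr : prime p) (R : realType).
Local Notation Qp := (padic p_pr).
Variable dx : {measure set Qp -> \bar R}.

(* The additive Haar measure: the translation-invariant Borel measure with
   total mass 1 on Z_p. *)
Definition is_haar :=
  (forall (a : Qp) (A : set Qp), measurable A ->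
     dx [set a + x | x in A] = dx A) /\
  dx (padic_integers p p_pr) = 1%E.

(* dx / |x|_p *)
Definition mult_measure (A : set Qp) : \bar R :=
  (\int[dx]_(x in A) ((padic_abs R x)^-1)%:E)%E.

Let mult_measure0 : mult_measure set0 = 0%E.
Proof. exact: integral_set0. Qed.

Let mult_measure_ge0 A : (0 <= mult_measure A)%E.
Proof.
by apply: integral_ge0 => x _; rewrite lee_fin invr_ge0 padic_abs_ge0.
Qed.

Let mult_measure_sigma_additive : semi_sigma_additive mult_measure.
Proof.
move=> A mA tA mUA; rewrite /mult_measure ge0_integral_bigcup//; first last.
- by move=> x _; rewrite lee_fin invr_ge0 padic_abs_ge0.
- apply/measurable_EFinP; apply: (measurable_funS measurableT) => //.
  exact: measurable_padic_absV.
apply: is_cvg_ereal_nneg_natsum_cond => n _ _.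
exact: mult_measure_ge0.
Qed.

HB.instance Definition _ := isMeasure.Build _ Qp R
  mult_measure mult_measure0 mult_measure_ge0 mult_measure_sigma_additive.

End Haar.

(* f is locally constant on A, for the topology induced on A. *)
Definition locally_constant_on (T : topologicalType) (U : Type) (A : set T)
    (f : T -> U) :=
  forall x, A x -> \forall z \near x, A z -> f z = f x.

Section mean_field.
Variables (p : nat) (p_pr : prime p) (R : realType).
Local Notation Qp := (padic p_pr).
Variables (dx : {measure set Qp -> \bar R}) (m : nat).
Local Notation F := (fund_domain p p_pr m).
Local Notation mu := (mult_measure dx).

Definition D_op (phi : Qp -> R) (x : Qp) : R :=
  padic_abs R x *
  \int[dx]_(z in F) ((phi z - phi x) / padic_abs R (z - x) ^+ 2).

(* A function on F `\ y is represented by a total function on Q_p: the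
   value u y is irrelevant, [set y] being negligible. *)
Definition mean_field_solution (rho : R) (y : Qp) (u : Qp -> R) :=
  [/\ locally_constant_on (F `\ y) u,
      mu.-integrable F (EFin \o u),
      mu.-integrable F (EFin \o (expR \o u)) &
      forall phi : Qp -> R, locally_constant_on F phi ->
        \int[mu]_(x in F) (u x * D_op phi x)
          + rho * \int[mu]_(x in F) (expR (u x) * phi x) = rho * phi y].

End mean_field.

(* Main.v *)
Require Import Defs.
From mathcomp Require Import all_boot all_order all_algebra.
From mathcomp Require Import all_classical all_reals all_analysis.
From mathcomp Require Import ring lra zify measurable_realfun.

(* Proof idea. The kernel 1/|z-x|^2 only sees the distance, so one looks for a
   solution depending only on the type (|x|, |x-y|) of x: two points of the same
   type are at the same distance from any point of another type. Modulo p^N this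
   is a finite problem, a mean field equation on a weighted graph, solved by
   minimising the convex-minus-log functional
     E(u)/2 + rho u(y) - rho ln(int e^u)
   over the functions of the type; the minimum exists as the quadratic form E
   beats the linear growth of the other terms.

   Bounds uniform in N: away from y, a value e^(u x) is at most the inverse of
   the mass of the points having the type of x, as int e^u = 1. On a ball B_n of
   radius p^-n around y the equation compares the value u_n on the sphere S_n
   with the mean alpha_n over B_n: 0 <= u_n - alpha_n <= rho (p + 1). Hence alpha
   decreases, at most linearly, so u is bounded above and no mass concentrates at
   y; at some point u is bounded below, and the equation at that point bounds the
   mean of |u|. An ultrafilter limit N -> oo then solves the equation on F; it
   is at least - c n - c on S_n, whence integrability. *)

Set Implicit Arguments.
Unset Strict Implicit.
Unset Printing Implicit Defensive.

Import Order.TTheory GRing.Theory Num.Theory.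
Import numFieldNormedType.Exports.

Local Open Scope classical_set_scope.
Local Open Scope ring_scope.

(** * Finite mean field equations *)

(** The functional is convex minus the convex term rho ln(int e^u), so uniqueness of the minimiser,
    and with it symmetry, cannot be read off from convexity. Symmetry is imposed on the competitors
    instead, and the equation is recovered because the residual of a symmetric function is itself
    symmetric. In return, outside a ball B_n around y the solution modulo p^N depends on residues
    modulo p^n only, for every N >= n: integrals off B_n are finite sums whose number of terms does
    not depend on N. The limit is delicate only at y, where the point mass has density p^N on a
    shrinking class. No limit is exchanged with an integral over B_n: the integrals of u and e^u
    over B_n converge as numbers A n and M n in their own right. The recursion from B_n to B_(n+1)
    and the decay of A n and M n to 0 identify them afterwards with integrals of the limit. The
    equation at y, lost in the limit, is recovered from the total mass. *)

Lemma ultrafilter_eventually :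
  exists2 G : set_system nat, UltraFilter G & eventually `<=` G.
Proof.
by have [G [GU ?]] := ultraFilterLemma eventually_filter; exists G.
Qed.

(** One filter [G] serves all bounded sequences at once, which replaces a diagonal extraction when
    infinitely many quantities must converge together. *)
Lemma ultra_bounded_cvg (R : realType) (G : set_system nat) (x : nat -> R)
    (a b : R) : UltraFilter G -> eventually `<=` G ->
  (\forall n \near \oo, a <= x n <= b) -> exists l : R, x @ G --> l.
Proof.
move=> GU oG xab.
have h : compact `[a, b]%classic by exact: segment_compact.
rewrite compact_ultra in h.
(* The image of an ultrafilter is an ultrafilter, since [G] contains the preimage of any set or of
   its complement. *)
have xU : UltraFilter (x @ G).
  split; first exact: fmap_proper_filter.
  move=> H HF sub; apply/seteqP; split=> // A HA.
  have [//|GA] := in_ultra_setVsetC (x @^-1` A) GU.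
  have HnA : H (~` A) by apply: sub.
  by have [z []] := @filter_ex _ H HF _ (filterI HA HnA).
have [|l [_ xl]] := h _ xU; last by exists l.
by apply: oG; apply: filterS xab => n xn; rewrite /= in_itv.
Qed.

Lemma cvg_sum_fin (R : realType) (T : Type) (G : set_system T)
    (I : Type) (r : seq I) (P : pred I) (f : I -> T -> R) (l : I -> R) :
  ProperFilter G -> (forall i, P i -> f i @ G --> l i) ->
  (fun n => \sum_(i <- r | P i) f i n) @ G --> \sum_(i <- r | P i) l i.
Proof.
move=> GF fl; elim: r => [|i r IH].
  by under eq_fun do rewrite big_nil; rewrite big_nil; exact: cvg_cst.
under eq_fun do rewrite big_cons; rewrite big_cons.
by case: ifP => // Pi; apply: cvgD => //; exact: fl.
Qed.

(** * Minimisation on a finite weighted graph, under a symmetry constraint *)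

Section variational.
Variables (R : realType) (V : finType) (P : pred V) (T : eqType) (tau : V -> T).
Variables (k : V -> V -> R) (mu : V -> R) (l : V) (rho : R).
Hypotheses (Pl : P l) (rho0 : 0 < rho)
  (tauP : forall c c', tau c = tau c' -> P c = P c')
  (taul : forall c, tau c = tau l -> c = l)
  (k_sym : forall c c', k c c' = k c' c)
  (k_ge0 : forall c c', 0 <= k c c')
  (k_gt0 : forall c, P c -> c != l -> 0 < k c l)
  (k_tau : forall c1 c2 c', tau c1 = tau c2 -> tau c' != tau c1 ->
     k c1 c' = k c2 c')
  (mu_gt0 : forall c, P c -> 0 < mu c)
  (mu_tau : forall c c', tau c = tau c' -> mu c = mu c').

Let Z (u : V -> R) := \sum_(c | P c) mu c * expR (u c).
Let Q (u v : V -> R) :=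
  \sum_(c | P c) \sum_(c' | P c') k c c' * (u c - u c') * (v c - v c').
Let J (u : V -> R) := Q u u / 4 + rho * u l - rho * ln (Z u).
Let inv (u : V -> R) := forall c c', tau c = tau c' -> u c = u c'.

Let Z_gt0 u : 0 < Z u.
Proof.
rewrite /Z (bigD1 l)//= ltr_pwDl// ?mulr_gt0 ?expR_gt0 ?mu_gt0//.
by apply: sumr_ge0 => c /andP[Pc _]; rewrite mulr_ge0 ?expR_ge0// ltW ?mu_gt0.
Qed.

(** The terms [u l] and [ln (Z u)] carry the same coefficient rho with opposite signs. Hence
    coercivity is only needed on the slice [u l = 0]. *)
Let J_shift u s : J (fun c => u c + s) = J u.
Proof.
rewrite /J; have -> : Q (fun c => u c + s) (fun c => u c + s) = Q u u.
  apply: eq_bigr => c _; apply: eq_bigr => c' _; ring.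
have -> : Z (fun c => u c + s) = Z u * expR s.
  by rewrite /Z mulr_suml; apply: eq_bigr => c _; rewrite expRD mulrA.
by rewrite lnM ?posrE ?expR_gt0// expRK; ring.
Qed.

(** Only the edges at [l] are kept; each occurs twice in the double sum, once in the row and once in
    the column of [l]. *)
Let Q_ge u : u l = 0 -> 2 * \sum_(c | P c) k c l * (u c) ^+ 2 <= Q u u.
Proof.
move=> ul; pose r := \sum_(c | P c) k c l * (u c) ^+ 2.
have -> : Q u u = r + (\sum_(c | P c && (c != l))
    \sum_(c' | P c') k c c' * (u c - u c') ^+ 2).
  rewrite /Q (bigD1 l)//=; congr (_ + _).
    by apply: eq_bigr => c _; rewrite ul k_sym; ring.
  by apply: eq_bigr => c _; apply: eq_bigr => c' _; ring.
rewrite -/r mulrDl mul1r lerD2l /r (bigD1 l)//= ul expr0n mulr0 add0r.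
apply: ler_sum => c _; rewrite (bigD1 l)//= ul subr0 lerDl.
by apply: sumr_ge0 => c' _; rewrite mulr_ge0 ?sqr_ge0.
Qed.

Let lnZ_le u : ln (Z u) <= ln (\sum_(c | P c) mu c) + \sum_(c | P c) `|u c|.
Proof.
have mu0 : 0 < \sum_(c | P c) mu c.
  by rewrite (bigD1 l)//= ltr_pwDl// ?mu_gt0// sumr_ge0// => c /andP[? _]; rewrite ltW ?mu_gt0.
rewrite -[X in _ + X]expRK -lnM ?posrE ?expR_gt0// ler_ln ?posrE ?mulr_gt0 ?expR_gt0//.
rewrite /Z mulr_suml; apply: ler_sum => c Pc; rewrite ler_pM2l ?mu_gt0// ler_expR.
rewrite (le_trans (ler_norm _))// (bigD1 c)//= lerDl.
by apply: sumr_ge0.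
Qed.

Let J_coercive : exists2 K : R, 0 < K & exists C : R, forall u, u l = 0 ->
  forall c, P c -> K * (u c) ^+ 2 <= J u + C.
Proof.
pose K := \big[Order.min/1]_(c | P c && (c != l)) k c l.
have K0 : 0 < K.
  rewrite /K; elim/big_ind: _ => //; first by move=> x y; rewrite lt_min => -> ->.
  by move=> c /andP[? ?]; exact: k_gt0.
have Kk c : P c -> c != l -> K <= k c l.
  by move=> Pc cl; rewrite /K (bigD1 c) ?Pc//= ge_min lexx.
exists (K / 4); first lra.
(* Each rho ^ 2 / K comes from completing the square: it absorbs rho |u c| at the price of half of
   the quadratic term. *)
exists (rho * ln (\sum_(c | P c) mu c) + \sum_(c | P c) rho ^+ 2 / K).
move=> u ul c Pc.
have h1 : K / 2 * \sum_(c | P c) (u c) ^+ 2 <= Q u u / 4.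
  have h := Q_ge ul; suff : K * (\sum_(c | P c) u c ^+ 2) <=
      \sum_(c | P c) k c l * u c ^+ 2 by lra.
  rewrite mulr_sumr; apply: ler_sum => c' Pc'.
  have [->|cl] := eqVneq c' l; first by rewrite ul expr0n !mulr0.
  by rewrite ler_wpM2r ?sqr_ge0// Kk.
have h2 := lnZ_le u.
have h3 : rho * ln (Z u) <= rho * (ln (\sum_(c | P c) mu c) + \sum_(c | P c) `|u c|).
  by rewrite ler_pM2l.
have h4 : K / 4 * u c ^+ 2 <= \sum_(c | P c) (K / 2 * u c ^+ 2 - rho * `|u c| + rho ^+ 2 / K).
  have a x : K / 4 * x ^+ 2 <= K / 2 * x ^+ 2 - rho * `|x| + rho ^+ 2 / K.
    rewrite -(real_normK (num_real x)); move: `|x| => t.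
    rewrite -subr_ge0.
    have -> : K / 2 * t ^+ 2 - rho * t + rho ^+ 2 / K - K / 4 * t ^+ 2 =
              K * (t / 2 - rho / K) ^+ 2 by field; rewrite gt_eqF.
    by rewrite mulr_ge0 ?sqr_ge0 ?ltW.
  rewrite (bigD1 c)//=; apply: ler_wpDr; last exact: a.
  apply: sumr_ge0 => c' _; apply: le_trans (a _).
  by rewrite mulr_ge0 ?sqr_ge0// ltW// divr_gt0.
move: h4; rewrite big_split/= big_split/= sumrN -!mulr_sumr => h4.
rewrite /J ul mulr0 addr0; lra.
Qed.

(** Convexity of ln Z along a line, in the form of Jensen's inequality: the left-hand sum is the
    mean b of eta for the weights mu e^v / Z v, and 1 + x <= e^x is applied to x = t (eta - b),
    whose mean is 0. The first variation of [J] then requires no differentiation. *)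
Let Z_tangent v eta (t : R) :
  t * (\sum_(c | P c) mu c * expR (v c) * eta c / Z v) <=
  ln (Z (fun c => v c + t * eta c)) - ln (Z v).
Proof.
set b := \sum_(c | P c) _.
rewrite -[leLHS]expRK -ln_div ?posrE// ler_ln ?posrE ?expR_gt0 ?divr_gt0//.
rewrite ler_pdivlMr//.
have -> : Z (fun c => v c + t * eta c) =
    expR (t * b) * \sum_(c | P c) mu c * expR (v c) * expR (t * (eta c - b)).
  rewrite /Z mulr_sumr; apply: eq_bigr => c _.
  rewrite expRD [in RHS]mulrBr expRD expRN; field.
  by rewrite gt_eqF ?expR_gt0.
rewrite ler_pM2l ?expR_gt0//.
have -> : Z v = \sum_(c | P c) mu c * expR (v c) * (1 + t * (eta c - b)).
  have bZ : \sum_(c | P c) mu c * expR (v c) * eta c = b * Z v.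
    rewrite /b mulr_suml; apply: eq_bigr => c _; field; by rewrite gt_eqF.
  transitivity (Z v + t * (\sum_(c | P c) mu c * expR (v c) * eta c - b * Z v)).
    by rewrite bZ subrr mulr0 addr0.
  rewrite /Z [b * _]mulr_sumr -sumrB mulr_sumr -big_split/=.
  by apply: eq_bigr => c _; ring.
apply: ler_sum => c Pc; rewrite ler_pM2l ?mulr_gt0 ?expR_gt0 ?mu_gt0//.
exact: expR_ge1Dx.
Qed.

Let minimizer : exists v, [/\ inv v & forall w, inv w -> J v <= J w].
Proof.
have [K K0 [C JC]] := J_coercive.
pose S := [set J u | u in [set u | inv u /\ u l = 0]].
have S0 : S !=set0 by exists (J (fun=> 0)), (fun=> 0).
have Slb : has_lbound S.
  exists (- C) => _ [u [_ ul] <-].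
  by have := JC u ul l Pl; rewrite ul; lra.
have Sinf : has_inf S by [].
have ex n : exists u, [/\ inv u, u l = 0 & J u < inf S + n.+1%:R^-1].
  have e0 : 0 < n.+1%:R^-1 :> R by rewrite invr_gt0.
  have [_ [u [ui ul] <-] h] := inf_adherent e0 Sinf; by exists u.
have [U HU] := choice ex.
have Sle n : J (U n) <= inf S + 1.
  have [_ _ /ltW/le_trans] := HU n; apply.
  by rewrite lerD2l invf_le1// ler1n.
have [G GU oG] := ultrafilter_eventually.
(* A bound x ^ 2 <= M gives |x| <= 1 + M, without a square root. *)
pose B := 1 + (inf S + 1 + C) / K.
have Ub n c : P c -> - B <= U n c <= B.
  move=> Pc; have [_ ul _] := HU n; have := JC _ ul _ Pc.
  have := Sle n => h1 h2.
  have h3 : (U n c) ^+ 2 <= (inf S + 1 + C) / K by rewrite ler_pdivlMr// mulrC; lra.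
  by rewrite /B; apply/andP; split; nra.
have ex2 c : exists x : R, P c -> (fun n => U n c) @ G --> x.
  have [Pc|nPc] := boolP (P c); last by exists (0 : R).
  have [x xU] : exists x : R, (fun n => U n c) @ G --> x.
    by apply: (ultra_bounded_cvg (a := - B) (b := B)) => //; near=> n; exact: Ub.
  by exists x.
have [v0 Hv0] := choice ex2.
(* Off [P] the minimising sequence may be unbounded; the value 0 there keeps [v] constant on types,
   as [P] is a union of types. *)
pose v c := if P c then v0 c else 0.
have vU c : P c -> (fun n => U n c) @ G --> v c.
  by move=> Pc; rewrite /v Pc; exact: Hv0.
have vi : inv v.
  move=> c c' cc'; rewrite /v -(tauP cc'); case: ifPn => // Pc.
  have Pc' : P c' by rewrite -(tauP cc').
  have h1 := Hv0 _ Pc; have h2 := Hv0 _ Pc'.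
  apply: (@cvg_unique _ _ (U^~ c @ G)) => //.
  suff -> : (U^~ c) = (U^~ c') by [].
  by apply/funext => n; have [+ _ _] := HU n; apply.
have JU : (fun n => J (U n)) @ G --> J v.
  apply: cvgB; last first.
    apply: cvgM; first exact: cvg_cst.
    apply: continuous_cvg; first exact: continuous_ln.
    apply: cvg_sum_fin => c Pc; apply: cvgM; first exact: cvg_cst.
    by apply: continuous_cvg; [exact: continuous_expR|exact: vU].
  apply: cvgD; last by apply: cvgM; [exact: cvg_cst|exact: vU].
  apply: cvgM; last exact: cvg_cst.
  apply: cvg_sum_fin => c Pc; apply: cvg_sum_fin => c' Pc'.
  apply: cvgM; last by apply: cvgB; exact: vU.
  by apply: cvgM; [exact: cvg_cst|apply: cvgB; exact: vU].
have Jv : J v <= inf S.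
  rewrite -[leRHS]addr0.
  apply: (ler_cvg_to JU (l' := inf S + 0) (g := fun n => inf S + n.+1%:R^-1)).
    apply: cvgD; first exact: cvg_cst.
    apply: cvg_trans (@cvg_harmonic R).
    by move=> A /oG.
  by near=> n; have [_ _ /ltW] := HU n.
exists v; split=> // w wi; apply: (le_trans Jv).
rewrite -(J_shift w (- w l)); apply: ge_inf => //.
exists (fun c => w c - w l); last by [].
by split=> [c c' cc'|]; [rewrite (wi _ _ cc')|rewrite subrr].
Unshelve. all: end_near. Qed.

(** Summation by parts: exchanging c and c' turns the part with [eta c'] into minus the part with
    [eta c]. *)
Let Q_lin v eta :
  Q v eta = 2 * \sum_(c | P c) eta c * \sum_(c' | P c') k c c' * (v c - v c').
Proof.
pose S1 := \sum_(c | P c) \sum_(c' | P c') k c c' * (v c - v c') * eta c.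
pose S2 := \sum_(c | P c) \sum_(c' | P c') k c c' * (v c - v c') * eta c'.
have -> : Q v eta = S1 - S2.
  rewrite -sumrB; apply: eq_bigr => c _; rewrite -sumrB; apply: eq_bigr => c' _.
  ring.
have -> : S2 = - S1.
  rewrite /S2 exchange_big/= -sumrN; apply: eq_bigr => c _.
  by rewrite -sumrN; apply: eq_bigr => c' _; rewrite k_sym; ring.
have -> : S1 - - S1 = 2 * S1 by ring.
apply: (congr1 ( *%R 2)); apply: eq_bigr => c _; rewrite mulr_sumr; apply: eq_bigr => c' _.
by rewrite mulrC.
Qed.

Let lin_quad_ge0 (a b : R) : (forall t, 0 <= t * a + t ^+ 2 * b) -> a = 0.
Proof.
move=> h; apply/eqP/negP => /negP a0.
have K0 : 0 < `|b| + 1 by rewrite ltr_pwDr.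
have a2 : 0 < a ^+ 2 by rewrite exprn_even_gt0.
(* At this point the quadratic term is at most half of the linear gain, so the sum is negative
   unless a = 0. *)
have := h (- (a / (`|b| + 1) / 2)).
have -> : - (a / (`|b| + 1) / 2) * a + (- (a / (`|b| + 1) / 2)) ^+ 2 * b =
  a ^+ 2 / (`|b| + 1) * (b / (`|b| + 1) / 4 - 1 / 2).
  by field; rewrite gt_eqF.
rewrite pmulr_rge0 ?divr_gt0//.
have : b / (`|b| + 1) <= 1 by rewrite ler_pdivrMr// mul1r (le_trans (ler_norm _))// lerDl.
lra.
Qed.

(** The minimiser is critical only for variations constant on types. This suffices: its residual [E]
    is constant on types, so testing against the indicator of one type makes [E] vanish there.
    Subtracting [ln (Z v)] changes no difference and normalises the mass to 1. *)
Lemma finite_mean_field : exists u : V -> R,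
  [/\ forall c c', tau c = tau c' -> u c = u c',
      \sum_(c | P c) mu c * expR (u c) = 1 &
      forall c, P c -> \sum_(c' | P c') k c c' * (u c - u c') =
        rho * (mu c * expR (u c) - (c == l)%:R)].
Proof.
have [v [vi vmin]] := minimizer.
pose E c := \sum_(c' | P c') k c c' * (v c - v c') + rho * (c == l)%:R
  - rho * (mu c * expR (v c) / Z v).
have E_tau c1 c2 : tau c1 = tau c2 -> E c1 = E c2.
  move=> c12; rewrite /E; congr (_ + rho * _%:R - rho * (_ / _)).
  (* Weights inside a type may depend on the point, but they multiply a zero difference; weights
     towards other types agree by [k_tau]. *)
  - apply: eq_bigr => c' _; have [c'1|c'1] := eqVneq (tau c') (tau c1).
      by rewrite -(vi _ _ c12) -(vi _ _ c'1) subrr !mulr0.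
    by rewrite (k_tau c12 c'1) (vi _ _ c12).
  - congr nat_of_bool; apply/eqP/eqP => h.
      by apply: taul; rewrite -h.
    by apply: taul; rewrite -h.
  - by rewrite (mu_tau c12) (vi _ _ c12).
have Etest eta : inv eta -> \sum_(c | P c) eta c * E c = 0.
  move=> ei; apply: (@lin_quad_ge0 _ (Q eta eta / 4)) => t.
  have wi : inv (fun c => v c + t * eta c).
    by move=> c c' cc'; rewrite (vi _ _ cc') (ei _ _ cc').
  have := vmin _ wi; rewrite -subr_ge0 => /le_trans; apply.
  have QE : Q (fun c => v c + t * eta c) (fun c => v c + t * eta c) =
      Q v v + 2 * t * Q v eta + t ^+ 2 * Q eta eta.
    rewrite /Q !mulr_sumr -!big_split/=; apply: eq_bigr => c _.
    rewrite !mulr_sumr -!big_split/=; apply: eq_bigr => c' _; ring.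
  have -> : \sum_(c | P c) eta c * E c = Q v eta / 2 + rho * eta l
     - rho * (\sum_(c | P c) mu c * expR (v c) * eta c / Z v).
    rewrite Q_lin [2 * _]mulrC mulfK//.
    have -> : rho * eta l = \sum_(c | P c) eta c * (rho * (c == l)%:R).
      rewrite (bigD1 l)//= eqxx mulr1 mulrC big1 ?addr0// => c /andP[_ /negbTE ->].
      by rewrite !mulr0.
    rewrite mulr_sumr -big_split -sumrB/=; apply: eq_bigr => c _; rewrite /E.
    ring.
  have := Z_tangent v eta t; rewrite -(ler_pM2l rho0) /J QE => h.
  lra.
have E0 c : P c -> E c = 0.
  move=> Pc; have ei : inv (fun c' => (tau c' == tau c)%:R).
    by move=> c1 c2 /= ->.
  have /eqP := Etest _ ei.
  rewrite (eq_bigr (fun c' => (tau c' == tau c)%:R * E c)); last first.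
    move=> c' _; case: eqVneq => [/E_tau -> //|_]; by rewrite !mul0r.
  rewrite -mulr_suml => h; apply/eqP; move: h.
  rewrite mulf_eq0 => /orP[|//]; rewrite (bigD1 c)//= eqxx gt_eqF//.
  by rewrite ltr_pwDl// sumr_ge0.
have uZ c : expR (v c - ln (Z v)) = expR (v c) / Z v.
  by rewrite expRD expRN lnK// posrE.
exists (fun c => v c - ln (Z v)); split.
- by move=> c c' /vi ->.
- under eq_bigr do rewrite uZ mulrA.
  by rewrite -mulr_suml divff// gt_eqF//; exact: Z_gt0.
- move=> c Pc; have := E0 _ Pc; rewrite /E uZ => h.
  rewrite (eq_bigr (fun c' => k c c' * (v c - v c'))); first by rewrite mulrA; lra.
  by move=> c' _; ring.
Qed.

End variational.

(** * Arithmetic of p-adic integers *)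

Section padic_integers_arith.
Variables (p : nat) (p_pr : prime p).
Local Notation Zp := (padic_int p_pr).
Implicit Types a b u : Zp.

Let p_gt0 : (0 < p)%N. Proof. exact: prime_gt0. Qed.

Lemma residueN a n : residue (- a) n = ((- residue a n) %% (p ^ n)%N)%Z.
Proof. by []. Qed.

Lemma residue_nat (c n : nat) : residue (c%:R : Zp) n = (c %% p ^ n)%N.
Proof.
rewrite -modz_nat; elim: c => [|c IH]; first by rewrite /= mod0z.
rewrite -natr1 residueD IH -addn1 PoszD -[in RHS]modzDml.
by rewrite [residue 1 n](_ : _ = (1 %% (p ^ n)%N)%Z)// modzDmr.
Qed.

Lemma residue_ge0 a n : (0 <= residue a n)%R.
Proof. by rewrite -residue_mod modz_ge0// eqz_nat expn_eq0 negb_and -lt0n p_gt0. Qed.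

Lemma residue_lt a n : (residue a n < (p ^ n)%N)%R.
Proof. by rewrite -residue_mod ltz_pmod// ltz_nat expn_gt0 p_gt0. Qed.

Lemma residue_subr_eq0 a b n : (residue (a - b) n == 0) = (residue a n == residue b n).
Proof.
rewrite residueD residueN modzDmr; apply/eqP/eqP => [h|->].
  rewrite -(residue_mod a) -(residue_mod b); apply/eqP.
  by rewrite eqz_mod_dvd; apply/dvdz_mod0P.
by rewrite subrr mod0z.
Qed.

Lemma residue_eq_le a b k n : (k <= n)%N ->
  residue a n = residue b n -> residue a k = residue b k.
Proof. by move=> kn ab; rewrite (residue_le a kn) (residue_le b kn) ab. Qed.

Lemma residue_eq0_val a n : a != 0 -> (residue a n == 0) = (n <= pint_val a)%N.
Proof.
move=> /pint_valP [a0 a1]; have [nv|nv] := leqP n (pint_val a).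
  by rewrite (residue_le a nv) a0 mod0z eqxx.
apply/negbTE; apply: contra a1 => /eqP h.
by rewrite (residue_le a nv) h mod0z.
Qed.

Lemma coprimez_residue a n : residue a 1 != 0 -> coprimez (residue a n) (p ^ n)%N.
Proof.
move=> a1; case: n => [|n]; first by rewrite expn0 /coprimez gcdz1.
rewrite coprimezE coprime_sym coprimeXl// prime_coprime//.
move: a1; rewrite (@residue_le _ _ a 1 n.+1)// expn1; apply: contra => h.
by apply/eqP/dvdz_mod0P; rewrite dvdzE.
Qed.

(** Bezout gives an inverse modulo each p^n. These choices are automatically coherent, because
    inverses modulo p^n are unique. *)
Lemma padic_int_unit a : residue a 1 != 0 -> a \is a GRing.unit.
Proof.
move=> a1.
have ex n : exists y : int, (y * residue a n = 1 %[mod (p ^ n)%N])%Z.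
  have /coprimezP[[u v] /= uv] := coprimez_residue n a1; exists u.
  by rewrite -uv -modzDmr modzMl addr0.
have [y Hy] := choice ex.
have ycoh n : (y n.+1 = y n %[mod (p ^ n)%N])%Z.
  have h : (y n.+1 * residue a n = 1 %[mod (p ^ n)%N])%Z.
    rewrite -modzMmr -residueS modzMmr -modz_expS Hy.
    by rewrite modz_expS.
  rewrite -[y n.+1]mulr1 -modzMmr -(Hy n) modzMmr mulrCA -modzMmr h modzMmr.
  by rewrite mulr1.
apply/asboolP; exists (mk_pint p_pr ycoh); apply: pint_P => n.
by rewrite residueM/= modzMml Hy.
Qed.

(** The cofactor is read v digits further along: its residue modulo p^n is that of [a] modulo
    p^(v+n), divided by p^v. *)
Lemma padic_int_factor a : a != 0 ->
  exists2 u, u \is a GRing.unit & a = p%:R ^+ pint_val a * u.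
Proof.
move=> a0; have [h0 h1] := pint_valP a0; set v := pint_val a in h0 h1 *.
have dv n : ((p ^ v)%N %| residue a (v + n))%Z.
  by apply/dvdz_mod0P; rewrite -(residue_le a (leq_addr n v)).
pose q n := (residue a (v + n) %/ (p ^ v)%N)%Z.
have qE n : residue a (v + n) = q n * (p ^ v)%N by rewrite /q divzK.
have pv0 : (p ^ v)%N%:Z != 0 by rewrite eqz_nat expn_eq0 negb_and -lt0n p_gt0.
have qcoh n : (q n.+1 = q n %[mod (p ^ n)%N])%Z.
  apply/eqP; rewrite eqz_mod_dvd -(dvdz_mul2r pv0) mulrBl.
  rewrite -!qE -PoszM -expnD [(n + v)%N]addnC -eqz_mod_dvd addnS.
  by rewrite residueS.
exists (mk_pint p_pr qcoh).
  apply: padic_int_unit => /=; apply: contra h1 => /eqP q0.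
  rewrite -residue_mod; have := qE 1%N; rewrite addn1 => ->.
  move/dvdz_mod0P/dvdzP: q0 => [r ->].
  by rewrite -mulrA -PoszM -expnD add1n modzMl.
apply: pint_P => n; rewrite residueM -natrX residue_nat/=.
by rewrite -modz_nat modzMml modzMmr mulrC -qE -(residue_le a (leq_addl v n)).
Qed.

Lemma residue_unit u : u \is a GRing.unit -> residue u 1 != 0.
Proof.
move=> uU; apply/eqP => u0.
have := congr1 (fun x : Zp => residue x 1) (divrr uU).
rewrite residueM u0 mul0r mod0z [residue 1 1](_ : _ = (1 %% (p ^ 1)%N)%Z)//.
by rewrite expn1 modz_small// ltz_nat prime_gt1.
Qed.

Lemma pint_val_unit u : u \is a GRing.unit -> pint_val u = 0%N.
Proof.
move=> /residue_unit; apply: pint_val_eq.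
by rewrite -residue_mod expn0 modz1.
Qed.

Lemma padic_of_int_inj : injective (@padic_of_int p p_pr).
Proof. by move=> a b /eqP; rewrite /padic_of_int tofrac_eq => /eqP. Qed.

Lemma padic_of_intM a b : padic_of_int (a * b) = padic_of_int a * padic_of_int b.
Proof. exact: tofracM. Qed.

Lemma padic_of_intB a b : padic_of_int (a - b) = padic_of_int a - padic_of_int b.
Proof. exact: tofracB. Qed.

Lemma padic_of_intD a b : padic_of_int (a + b) = padic_of_int a + padic_of_int b.
Proof. exact: tofracD. Qed.

Lemma padic_of_int_nat (c : nat) : padic_of_int (c%:R : Zp) = c%:R.
Proof. exact: tofracMn. Qed.

Lemma padic_of_intXn a n : padic_of_int (a ^+ n) = padic_of_int a ^+ n.
Proof. exact: tofracXn. Qed.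

(** F is the set of integers of valuation less than m, so membership is a condition on a single
    residue and F is a union of classes modulo p^m. *)
Lemma fund_domainE m :
  fund_domain p p_pr m = @padic_of_int p p_pr @` [set a | residue a m != 0].
Proof.
apply/seteqP; split => [x [k km [_ [u uU <-] <-]]|_ [a am <-]].
  exists (p%:R ^+ k * u); last first.
    by rewrite padic_of_intM padic_of_intXn padic_of_int_nat.
  have u0 : u != 0 by apply: contraL uU => /eqP ->; rewrite unitr0.
  have pk0 : (p%:R ^+ k : Zp) != 0.
    rewrite expf_eq0 negb_and; apply/orP; right; apply/eqP.
    move=> /(congr1 (fun x : Zp => residue x 2)); rewrite residue_nat.
    rewrite modn_small; last by rewrite -[ltnLHS]expn1 ltn_exp2l ?prime_gt1.
    by rewrite /= mod0z => -[] h; move: p_gt0; rewrite h.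
  have vk : pint_val (p%:R ^+ k : Zp) = k.
    apply: pint_val_eq; rewrite -natrX residue_nat ?modnn//.
    by rewrite modn_small ?ltn_exp2l ?prime_gt1// eqz_nat expn_eq0 negb_and -lt0n p_gt0.
  suff : residue (p%:R ^+ k * u) m != 0 by [].
  rewrite residue_eq0_val ?mulf_neq0// pint_valM// vk (pint_val_unit uU).
  by rewrite addn0 -ltnNge.
have a0 : a != 0 by apply: contraNneq am => ->; rewrite /= mod0z.
have [u uU ae] := padic_int_factor a0.
exists (pint_val a); first by move: am; rewrite /= residue_eq0_val// -ltnNge.
exists (padic_of_int u); first by exists u.
by rewrite [in RHS]ae padic_of_intM padic_of_intXn padic_of_int_nat.
Qed.

(** * The absolute value on Z_p in terms of residues *)

Section nrm.
Variable R : realFieldType.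

Definition nrm a : R := padic_abs R (padic_of_int a).

Let p1 : 1 < p%:R :> R. Proof. by rewrite ltr1n prime_gt1. Qed.
Let p0 : 0 < p%:R :> R. Proof. by rewrite ltr0n. Qed.

Lemma padic_abs_frac a b : b != 0 ->
  padic_abs R (padic_of_int a / padic_of_int b) =
  if a == 0 then 0 else p%:R ^ ((pint_val b)%:Z - (pint_val a)%:Z).
Proof.
move=> b0; rewrite /padic_abs mulf_eq0 invr_eq0 !padic_of_int_eq0 (negbTE b0) orbF.
by case: ifPn => // a0; rewrite padic_val_frac// opprB.
Qed.

Lemma nrmE a : nrm a = if a == 0 then 0 else p%:R ^- pint_val a.
Proof.
have := @padic_abs_frac a 1 (oner_neq0 _).
rewrite [padic_of_int 1]tofrac1 divr1 -/(nrm a) => ->; case: ifP => // _.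
by rewrite pint_val_unit ?unitr1// sub0r exprnN.
Qed.

Lemma nrm_le a n : (nrm a <= p%:R ^- n) = (residue a n == 0).
Proof.
rewrite nrmE; have [->|a0] := eqVneq a 0.
  by rewrite /= mod0z eqxx invr_ge0 exprn_ge0// ltW.
by rewrite residue_eq0_val// lef_pV2 ?posrE ?exprn_gt0// ler_eXn2l.
Qed.

Lemma nrm_ge0 a : 0 <= nrm a. Proof. exact: padic_abs_ge0. Qed.

Lemma nrm_gt0 a : a != 0 -> 0 < nrm a.
Proof. by move=> a0; rewrite padic_abs_gt0// padic_of_int_eq0. Qed.

Lemma nrm_eq0 a : (nrm a == 0) = (a == 0).
Proof.
have [->|/nrm_gt0 /gt_eqF//] := eqVneq a 0; by rewrite nrmE !eqxx.
Qed.

Lemma nrm_le1 a : nrm a <= 1.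
Proof.
by have := nrm_le a 0; rewrite expr0 invr1 => ->; rewrite -residue_mod expn0 modz1.
Qed.

Lemma nrmN a : nrm (- a) = nrm a.
Proof.
rewrite !nrmE oppr_eq0; case: eqVneq => // a0; congr (_ ^- _).
have [h0 h1] := pint_valP a0.
have e k : (residue (- a) k == 0) = (residue a k == 0).
  by rewrite -[- a]sub0r residue_subr_eq0 /= mod0z eq_sym.
by apply: pint_val_eq; [apply/eqP; rewrite e h0|rewrite e].
Qed.

Lemma nrmBC a b : nrm (a - b) = nrm (b - a).
Proof. by rewrite -nrmN opprB. Qed.

Lemma nrm_close a b n : (nrm (a - b) <= p%:R ^- n) = (residue a n == residue b n).
Proof. by rewrite nrm_le residue_subr_eq0. Qed.

Lemma nrm_loc_cst a b : nrm (b - a) < nrm a -> nrm b = nrm a.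
Proof. by rewrite /nrm padic_of_intB; exact: padic_abs_loc_cst. Qed.

(* Both sides are [max (nrm (a1 - c)) (nrm (b - c))]. *)
Lemma nrm_isosceles a1 a2 b c : nrm (a1 - c) = nrm (a2 - c) ->
  nrm (b - c) != nrm (a1 - c) -> nrm (a1 - b) = nrm (a2 - b).
Proof.
have key a : nrm (b - c) != nrm (a - c) ->
    nrm (a - b) = Num.max (nrm (a - c)) (nrm (b - c)).
  rewrite neq_lt => /orP[] h.
    rewrite max_l ?(ltW h)//; apply: nrm_loc_cst.
    have -> : a - b - (a - c) = c - b by ring.
    by rewrite [ltLHS]nrmBC.
  rewrite max_r ?(ltW h)// nrmBC; apply: nrm_loc_cst.
  have -> : b - a - (b - c) = c - a by ring.
  by rewrite [ltLHS]nrmBC.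
by move=> e h; rewrite !key -?e.
Qed.

Lemma nrm_cong n a b : residue a n = residue b n -> residue a n != 0 ->
  nrm a = nrm b.
Proof.
move=> /eqP ab an; apply/esym/nrm_loc_cst; rewrite nrmBC.
rewrite -nrm_close in ab; apply: (le_lt_trans ab).
by rewrite ltNge nrm_le.
Qed.

Lemma nrm_cong_sub n a b (c : Zp) : residue a n = residue b n ->
  residue a n != residue c n -> nrm (a - c) = nrm (b - c).
Proof.
move=> ab ac; apply: (@nrm_cong n); last by rewrite residue_subr_eq0.
apply/eqP; rewrite -residue_subr_eq0.
have -> : a - c - (b - c) = a - b by ring.
by rewrite residue_subr_eq0 ab.
Qed.

Lemma nrm_eq_residue0 n a b : nrm a = nrm b -> (residue a n == 0) = (residue b n == 0).
Proof. by move=> ab; rewrite -!nrm_le ab. Qed.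

Lemma nrm_eq_residue n a b (c : Zp) : nrm (a - c) = nrm (b - c) ->
  (residue a n == residue c n) = (residue b n == residue c n).
Proof. by move=> ab; rewrite -!nrm_close ab. Qed.

Lemma nrm_val n a : residue a n = 0 -> residue a n.+1 != 0 -> nrm a = p%:R ^- n.
Proof.
move=> h0 h1; rewrite nrmE (pint_val_eq h0 h1); case: eqP => // a0.
by move: h1; rewrite a0 /= mod0z eqxx.
Qed.

End nrm.

Fact cell_subproof N : (0 < p ^ N)%N.
Proof. by rewrite expn_gt0 p_gt0. Qed.

(** Residues lie in [0, p^N), so the default element of [insubd] is never returned. *)
Definition cell N a : 'I_(p ^ N) :=
  insubd (Ordinal (cell_subproof N)) `|residue a N|%N.

Lemma residue_cell N a : residue ((cell N a)%:R : Zp) N = residue a N.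
Proof.
have h : (`|residue a N| < p ^ N)%N.
  by have := residue_lt a N; have := residue_ge0 a N; lia.
rewrite residue_nat /cell val_insubd h modn_small//.
by have := residue_ge0 a N; lia.
Qed.

Lemma cell_nat N (c : 'I_(p ^ N)) : cell N c%:R = c.
Proof.
apply/val_inj => /=; have := residue_cell N (c%:R).
by rewrite !residue_nat !modn_small// => -[].
Qed.

Lemma cell_eq N a b : residue a N = residue b N -> cell N a = cell N b.
Proof. by rewrite /cell => ->. Qed.

Lemma padic_integersE (R : realFieldType) (x : padic p_pr) :
  padic_abs R x <= 1 -> exists a, x = padic_of_int a.
Proof.
rewrite (padicE x); have : (val (repr x)).2 != 0 by exact: denom_ratioP.
move: (val (repr x)) => [n d] /= d0; rewrite padic_abs_frac//.
have [-> _|n0] := eqVneq n 0; first by exists 0; rewrite /padic_of_int tofrac0 mul0r.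
rewrite -[leRHS](expr0z p%:R) ler_eXz2l ?ltr1n ?prime_gt1//.
rewrite subr_le0 lez_nat => vd.
have [u uU ->] := padic_int_factor n0; have [w wU de] := padic_int_factor d0.
exists (p%:R ^+ (pint_val n - pint_val d) * u * w^-1).
have d0' : padic_of_int d != 0 by rewrite padic_of_int_eq0.
apply/(canLR (mulfK d0')); rewrite -padic_of_intM; congr padic_of_int.
rewrite [X in _ = _ * X]de -[in LHS](subnK vd) exprD -[in LHS](mulr1 u) -(mulVr wU).
ring.
Qed.

(** * Integration over Z_p as an average over residue classes *)

Section mean.
Variable R : realType.
Implicit Types (f g : Zp -> R).

(* The integral over Z_p of a function which only depends on residues
   modulo p^N, see [zp_mean_refine]. *)
Definition zp_mean N f : R := p%:R ^- N * \sum_(c < p ^ N) f c%:R.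

Definition level N (T : Type) (f : Zp -> T) :=
  forall a b, residue a N = residue b N -> f a = f b.

Let p0 : 0 < p%:R :> R. Proof. by rewrite ltr0n. Qed.

Lemma sum_periodic (K q : nat) (g : nat -> R) : (forall i, g (K + i)%N = g i) ->
  \sum_(c < q * K) g c = q%:R * \sum_(c < K) g c.
Proof.
move=> gK; elim: q => [|q IH]; first by rewrite mul0n big_ord0 mul0r.
rewrite mulSn big_split_ord/= -natr1 mulrDl mul1r addrC -IH; congr (_ + _).
by apply: eq_bigr => i _; rewrite gK.
Qed.

Lemma zp_mean_refine n N f : (n <= N)%N -> level n f -> zp_mean N f = zp_mean n f.
Proof.
move=> nN fn; rewrite /zp_mean -(subnK nN) expnD.
rewrite (@sum_periodic _ _ (fun c => f c%:R)); last first.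
  by move=> i; apply: fn; rewrite !residue_nat modnDl.
rewrite natrX exprD invfM mulrACA mulVf ?mul1r// gt_eqF// exprn_gt0//.
Qed.

Lemma eq_zp_mean N f g : f =1 g -> zp_mean N f = zp_mean N g.
Proof. by move=> fg; congr (_ * _); apply: eq_bigr => c _; exact: fg. Qed.

Lemma zp_meanD N f g : zp_mean N (fun a => f a + g a) = zp_mean N f + zp_mean N g.
Proof. by rewrite /zp_mean big_split/= mulrDr. Qed.

Lemma zp_meanZ N r f : zp_mean N (fun a => r * f a) = r * zp_mean N f.
Proof. by rewrite /zp_mean -mulr_sumr mulrCA. Qed.

Lemma zp_meanB N f g : zp_mean N (fun a => f a - g a) = zp_mean N f - zp_mean N g.
Proof. by rewrite /zp_mean sumrB mulrBr. Qed.

Lemma le_zp_mean N f g : (forall a, f a <= g a) -> zp_mean N f <= zp_mean N g.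
Proof.
move=> fg; apply: ler_wpM2l; first by rewrite invr_ge0 exprn_ge0// ltW.
by apply: ler_sum => c _.
Qed.

Lemma zp_mean_ge0 N f : (forall a, 0 <= f a) -> 0 <= zp_mean N f.
Proof.
move=> f0; apply: mulr_ge0; first by rewrite invr_ge0 exprn_ge0// ltW.
by apply: sumr_ge0.
Qed.

Lemma exchange_zp_mean N (f : Zp -> Zp -> R) :
  zp_mean N (fun a => zp_mean N (f a)) = zp_mean N (fun b => zp_mean N (f ^~ b)).
Proof. by rewrite /zp_mean -!mulr_sumr exchange_big. Qed.

Lemma zp_mean_cst N r : zp_mean N (fun=> r) = r.
Proof.
rewrite /zp_mean sumr_const card_ord -[r *+ _]mulr_natr natrX mulrC mulfK//.
by rewrite gt_eqF// exprn_gt0.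
Qed.

Definition ball n a b : R := (residue a n == residue b n)%:R.

Lemma ball_ge0 n a b : 0 <= ball n a b. Proof. exact: ler0n. Qed.

Lemma ball_le1 n a b : ball n a b <= 1. Proof. by rewrite /ball; case: eqP => _; rewrite ?lexx ?ler01. Qed.

Lemma level_ball n a : level n (ball n a).
Proof. by move=> b c bc; rewrite /ball bc. Qed.

Lemma zp_mean_ball n N a : (n <= N)%N -> zp_mean N (ball n a) = p%:R ^- n.
Proof.
move=> nN; rewrite (zp_mean_refine nN) /zp_mean; last exact: level_ball.
have an : (`|residue a n| < p ^ n)%N by have := residue_lt a n; have := residue_ge0 a n; lia.
rewrite (bigD1 (Ordinal an))//= big1 ?addr0; last first.
  move=> c ca; rewrite /ball residue_nat modn_small//.
  case: eqP => // e; move/negP: ca; case; apply/eqP/val_inj => /=.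
  by rewrite e.
rewrite /ball residue_nat modn_small// gez0_abs ?residue_ge0// eqxx mulr1//.
Qed.

Lemma zp_mean_ball_cst n N a f : (n <= N)%N ->
  (forall b, residue a n = residue b n -> f b = f a) ->
  zp_mean N (fun b => ball n a b * f b) = p%:R ^- n * f a.
Proof.
move=> nN fa; rewrite -(zp_mean_ball a nN) mulrC -zp_meanZ.
apply: eq_zp_mean => b; rewrite /ball; case: eqP => [/fa ->|_]; last by rewrite !(mul0r,mulr0).
by rewrite mulr1 mul1r.
Qed.

End mean.

End padic_integers_arith.

Arguments nrm_cong {p p_pr R n a b} _ _.
Arguments nrm_cong_sub {p p_pr R n a b c} _ _.
Arguments nrm_val {p p_pr R n a} _ _.

(** * The equation modulo p^N and its limit *)

Section truncated.
Variables (p : nat) (p_pr : prime p) (R : realType) (m : nat).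
Local Notation Zp := (padic_int p_pr).
Local Notation nrm := (@nrm p p_pr R).
Local Notation zp_mean := (@zp_mean p p_pr R).
Local Notation ball := (@ball p p_pr R).
Implicit Types a b : Zp.
Variables (y : Zp) (rho : R).
Hypotheses (ym : residue y m != 0) (rho0 : 0 < rho).

Let p1 : 1 < p%:R :> R. Proof. by rewrite ltr1n prime_gt1. Qed.
Let p0 : 0 < p%:R :> R. Proof. by rewrite ltr0n prime_gt0. Qed.
Let px0 n : 0 < p%:R ^- n :> R. Proof. by rewrite invr_gt0 exprn_gt0. Qed.

Definition dom a : bool := residue a m != 0.

Local Notation F a := ((dom a)%:R : R).

(** The equation is divided by |a|, that is, written with respect to dx; the unit mass at y then has
    density p^N on the class of y modulo p^N. *)
Definition mean_field_level N (U : Zp -> R) := [/\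
  level N U,
  forall a b, dom a -> residue a N != residue y N ->
    nrm a = nrm b -> nrm (a - y) = nrm (b - y) -> U a = U b,
  zp_mean N (fun a => F a * (expR (U a) / nrm a)) = 1 &
  forall a, dom a ->
    zp_mean N (fun b => F b * ((U a - U b) / nrm (a - b) ^+ 2)) =
    rho * (expR (U a) / nrm a - p%:R ^+ N * (residue a N == residue y N)%:R)].

Lemma mean_field_level_ex N : (m <= N)%N -> exists U, mean_field_level N U.
Proof.
move=> mN.
pose V := 'I_(p ^ N).
pose pt (c : V) : Zp := c%:R.
pose P : pred V := fun c => dom (pt c).
pose tau c := (nrm (pt c), nrm (pt c - y)).
pose q : R := p%:R ^- N.
have q0 : 0 < q by exact: px0.
(* One factor q per integration variable, which makes [k] symmetric; the pointwise equation is the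
   graph equation divided by q. *)
pose k c c' := q ^+ 2 / nrm (pt c - pt c') ^+ 2.
pose mu c := q / nrm (pt c).
pose l := cell N y.
have resl : residue (pt l) N = residue y N by exact: residue_cell.
have dom_eq a b : residue a N = residue b N -> dom a = dom b.
  by move=> /(residue_eq_le mN) ab; rewrite /dom ab.
have dom_nrm a b : residue a N = residue b N -> dom a -> nrm a = nrm b.
  by move=> /(residue_eq_le mN) ab; exact: nrm_cong.
have Pl : P l by rewrite /P (dom_eq _ _ resl).
have pt_inj c c' : residue (pt c) N = residue (pt c') N -> c = c'.
  by move=> h; rewrite -(cell_nat p_pr c) -(cell_nat p_pr c'); exact: cell_eq.
have [||||||||u [u1 u2 u3]] := @finite_mean_field R V P _ tau k mu l rho Pl rho0.
- by move=> c c' [/(nrm_eq_residue0 m) h _]; rewrite /P /dom h.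
- move=> c [_ h]; apply: pt_inj; rewrite resl; apply/eqP.
  by rewrite (nrm_eq_residue _ h) resl.
- by move=> c c'; rewrite /k nrmBC.
- by move=> c c'; rewrite /k divr_ge0 ?sqr_ge0.
- move=> c Pc cl; rewrite /k divr_gt0 ?exprn_gt0// nrm_gt0// subr_eq0.
  by apply: contra_neq cl => h; apply: pt_inj; rewrite h.
- move=> c1 c2 c' [e1 e2]; rewrite /tau xpair_eqE negb_and => h.
  congr (_ / _ ^+ 2); case/orP: h => h.
    by apply: (@nrm_isosceles _ _ _ _ _ _ 0); rewrite !subr0.
  exact: (@nrm_isosceles _ _ _ _ _ _ y).
- move=> c Pc; rewrite /mu divr_gt0// nrm_gt0//.
  by apply: contraTneq Pc => e; rewrite /P /dom e /= mod0z eqxx.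
- by move=> c c' /(congr1 fst) /= e; rewrite /mu e.
pose U a := u (cell N a).
have UN : level N U by move=> a b /cell_eq ab; rewrite /U ab.
have Upt c : U (pt c) = u c by rewrite /U /pt cell_nat.
exists U; split => //.
- move=> a b da ay ab aby.
  have bN : residue b N != residue y N by rewrite -(nrm_eq_residue _ aby).
  have db : dom b by rewrite /dom -(nrm_eq_residue0 _ ab).
  have e (c : Zp) : dom c -> residue c N != residue y N ->
      tau (cell N c) = (nrm c, nrm (c - y)).
    move=> dc cy; rewrite /tau /pt; have h := residue_cell N c.
    rewrite -(dom_nrm _ _ (esym h))//; congr (_, _).
    by apply: (nrm_cong_sub (n := N)) => //; rewrite h.
  by apply: u1; rewrite !e// ab aby.
- rewrite -[RHS]u2 /zp_mean mulr_sumr [RHS]big_mkcond/=; apply: eq_bigr => c _.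
  rewrite /P -/(pt c); case: (dom (pt c)); last by rewrite mul0r mulr0.
  by rewrite Upt /mu mul1r -/q; ring.
move=> a da; pose c := cell N a.
have ca : residue (pt c) N = residue a N by exact: residue_cell.
have Pc : P c by rewrite /P (dom_eq _ _ ca).
have := u3 _ Pc; rewrite -(UN _ _ ca) Upt (dom_nrm _ _ (esym ca))//.
have -> : (residue a N == residue y N) = (c == l).
  by apply/eqP/eqP => [h|h]; [apply: pt_inj; rewrite ca resl|rewrite -ca -resl h].
rewrite big_mkcond/= => h.
have -> : zp_mean N (fun b => F b * ((u c - U b) / nrm (a - b) ^+ 2)) =
  q^-1 * \sum_i (if P i then k c i * (u c - u i) else 0).
  rewrite /zp_mean -/q !mulr_sumr; apply: eq_bigr => i _; rewrite /P -/(pt i).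
  case: (dom (pt i)); last by rewrite mul0r !mulr0.
  rewrite Upt mul1r /k; have [->|ic] := eqVneq i c; first by rewrite subrr !(mul0r,mulr0).
  rewrite (_ : nrm (a - pt i) = nrm (pt c - pt i)); last first.
    apply: (nrm_cong_sub (n := N)) => //; rewrite -ca; apply: contra ic => /eqP.
    by move=> /pt_inj ->.
  have n0 : nrm (pt c - pt i) != 0.
    rewrite nrm_eq0 subr_eq0; apply: contra_neq ic => e.
    by apply: pt_inj; rewrite e.
  by field; rewrite n0 gt_eqF.
have nc0 : nrm (pt c) != 0.
  rewrite nrm_eq0; apply: contraTneq Pc => e.
  by rewrite /P /dom e /= mod0z eqxx.
by rewrite h /mu -[p%:R ^+ N]invrK -/q; field; rewrite nc0 gt_eqF.
Qed.

Definition sphere n a : bool :=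
  (residue a n == residue y n) && (residue a n.+1 != residue y n.+1).

(** This point represents the sphere wherever the common value of a function on it is needed, in
    particular in the limit profile. *)
Lemma sphere_shift n : sphere n (y + (p ^ n)%:R).
Proof.
rewrite /sphere -!residue_subr_eq0 [y + _]addrC addrK !residue_nat.
rewrite modnn eqxx/= modn_small ?ltn_exp2l ?prime_gt1//.
by rewrite eqz_nat expn_eq0 negb_and -lt0n prime_gt0.
Qed.

Lemma nrm_sphere n a : sphere n a -> nrm (a - y) = p%:R ^- n.
Proof.
move=> /andP[h0 h1]; apply: nrm_val; last by rewrite residue_subr_eq0.
by apply/eqP; rewrite residue_subr_eq0.
Qed.

Lemma sphere_ex n N a : (n <= N)%N -> residue a n = residue y n ->
  residue a N != residue y N -> exists2 k, (n <= k < N)%N & sphere k a.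
Proof.
move=> nN an; elim: N nN => [|N IH].
  by rewrite leqn0 => /eqP n0; rewrite -n0 an eqxx.
rewrite leq_eqVlt => /orP[/eqP <-|]; first by rewrite an eqxx.
rewrite ltnS => nN aN1; have [aN|aN] := eqVneq (residue a N) (residue y N).
  by exists N; rewrite ?nN ?ltnSn// /sphere aN eqxx.
have [k /andP[nk kN] ak] := IH nN aN.
by exists k => //; rewrite nk ltnW.
Qed.

Lemma near_y n a : (m <= n)%N -> residue a n = residue y n -> dom a /\ nrm a = nrm y.
Proof.
move=> mn /(residue_eq_le mn) ay; split; first by rewrite /dom ay.
by apply: (nrm_cong ay); rewrite ay.
Qed.

(** * Estimates uniform in N *)

Section bounds.
Variables (N : nat) (U : Zp -> R).
Hypotheses (mN : (m <= N)%N) (HU : mean_field_level N U).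

Let U_level : level N U. Proof. by case: HU. Qed.

Let mass1 : zp_mean N (fun a => F a * (expR (U a) / nrm a)) = 1.
Proof. by case: HU. Qed.

(** Off the ball of radius p^-n around y, congruence modulo p^n preserves the type. Thus [U] has
    level n there, however large N is. *)
Lemma truncated_loc_cst n a b : (m <= n <= N)%N -> dom a ->
  residue a n != residue y n -> residue a n = residue b n ->
  [/\ dom b, nrm a = nrm b, nrm (a - y) = nrm (b - y) & U a = U b].
Proof.
move=> /andP[mn nN] da ay ab.
have abm := residue_eq_le mn ab.
have e1 : nrm a = nrm b by exact: nrm_cong abm da.
have e2 : nrm (a - y) = nrm (b - y) by exact: nrm_cong_sub ab ay.
split => //; first by rewrite /dom -abm.
case: HU => _ + _ _; apply => //.
by apply: contra ay => /eqP h; rewrite (residue_eq_le nN h).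
Qed.

Lemma truncated_sphere n a b : (m <= n < N)%N -> sphere n a -> sphere n b ->
  U a = U b.
Proof.
move=> /andP[mn nN] Sa Sb.
have /andP[/eqP a1 a2] := Sa; have /andP[/eqP b1 _] := Sb.
have [da ea] := near_y mn a1; have [_ eb] := near_y mn b1.
case: HU => _ + _ _; apply => //.
- by apply: contra a2 => /eqP h; rewrite (residue_eq_le nN h).
- by rewrite ea eb.
- by rewrite !(nrm_sphere (n := n)).
Qed.

Lemma truncated_exp_le n a : (m <= n <= N)%N -> dom a ->
  residue a n != residue y n -> p%:R ^- n * (expR (U a) / nrm a) <= 1.
Proof.
move=> mnN da ay; have /andP[mn nN] := mnN.
rewrite -(@zp_mean_ball_cst _ p_pr R n N a (fun a => expR (U a) / nrm a))//.
  rewrite -mass1; apply: le_zp_mean => b; rewrite /ball.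
  case: eqP => [ab|_]; last by rewrite mul0r mulr_ge0// divr_ge0 ?expR_ge0 ?nrm_ge0.
  by have [-> _ _ _] := truncated_loc_cst mnN da ay ab.
by move=> b ab; have [_ -> _ ->] := truncated_loc_cst mnN da ay ab.
Qed.

(** An integral over the ball, not an average: the alpha_n of the overview is
    [p%:R ^+ n * ball_sum U n]. *)
Definition ball_sum (g : Zp -> R) n := zp_mean N (fun a => ball n y a * g a).

Lemma ball_sum_rec (g : Zp -> R) n s : (n < N)%N ->
  (forall b, sphere n b -> g b = g s) ->
  ball_sum g n = (p%:R ^- n - p%:R ^- n.+1) * g s + ball_sum g n.+1.
Proof.
move=> nN gs; apply/eqP; rewrite -subr_eq; apply/eqP.
rewrite -(zp_mean_ball R y (ltnW nN)) -(zp_mean_ball R y nN).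
rewrite -!zp_meanB mulrC -zp_meanZ; apply: eq_zp_mean => b.
rewrite /ball -mulrBl; have [yb|yb] := eqVneq (residue y n.+1) (residue b n.+1).
  by rewrite (residue_eq_le (leqnSn n) yb) eqxx subrr mul0r mulr0.
have [yb'|yb'] := eqVneq (residue y n) (residue b n); last first.
  by rewrite subr0 mul0r mulr0.
by rewrite subr0 mul1r mulr1 gs// /sphere yb' eqxx/= eq_sym.
Qed.

Let mass_le1 n : (m <= n)%N ->
  0 <= ball_sum (expR \o U) n / nrm y <= 1.
Proof.
move=> mn; apply/andP; split.
  rewrite divr_ge0 ?nrm_ge0// zp_mean_ge0// => a.
  by rewrite mulr_ge0 ?ball_ge0// expR_ge0.
rewrite -mass1 mulrC -zp_meanZ; apply: le_zp_mean => b; rewrite /ball.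
case: eqP => [/esym/(near_y mn)[-> ->]|_]; first by rewrite !mul1r/= mulrC.
by rewrite mul0r mulr0 mulr_ge0// divr_ge0 ?expR_ge0 ?nrm_ge0.
Qed.

(** The kernel from the ball to an outside point b. It is evaluated at y because all points of the
    ball are at the same distance from b. *)
Let W n b := F b * ((1 - ball n y b) / nrm (y - b) ^+ 2).

Let W_ge0 n b : 0 <= W n b.
Proof. by rewrite mulr_ge0// divr_ge0 ?sqr_ge0// subr_ge0 ball_le1. Qed.

(* The equation summed over a ball [B] around [y]: only the interaction of [B]
   with its complement contributes. *)
Let ball_equation n : (m <= n <= N)%N ->
  zp_mean N (W n) * ball_sum U n - p%:R ^- n * zp_mean N (fun b => W n b * U b) =
  rho * (ball_sum (expR \o U) n / nrm y - 1).
Proof.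
move=> /andP[mn nN].
(* The interaction inside the ball is antisymmetric, so its double integral vanishes. *)
pose G a b := ball n y a * ball n y b * ((U a - U b) / nrm (a - b) ^+ 2).
have G0 : zp_mean N (fun a => zp_mean N (G a)) = 0.
  have : zp_mean N (fun a => zp_mean N (G a)) = - zp_mean N (fun a => zp_mean N (G a)).
    rewrite [RHS](_ : _ = zp_mean N (fun a => zp_mean N (fun b => G b a))).
      by rewrite exchange_zp_mean.
    rewrite -mulN1r -zp_meanZ; apply: eq_zp_mean => a.
    rewrite -zp_meanZ; apply: eq_zp_mean => b.
    by rewrite /G nrmBC; ring.
  lra.
have E a : ball n y a * zp_mean N (fun b => F b * ((U a - U b) / nrm (a - b) ^+ 2)) =
    ball n y a * rho * (expR (U a) / nrm y - p%:R ^+ N * ball N y a).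
  rewrite /ball; case: eqP => [/esym ay|_]; last by rewrite !mul0r.
  have [da ea] := near_y mn ay.
  by case: HU => _ _ _ ->//; rewrite ea [residue y N == _]eq_sym !mul1r.
transitivity (zp_mean N (fun a => ball n y a *
    zp_mean N (fun b => F b * ((U a - U b) / nrm (a - b) ^+ 2)))).
  transitivity (zp_mean N (fun a => ball n y a * (zp_mean N (W n) * U a - zp_mean N (fun b => W n b * U b)))
     + zp_mean N (fun a => zp_mean N (G a))).
    rewrite G0 addr0 -(zp_mean_ball R y nN) [in X in _ - X]mulrC -!zp_meanZ -zp_meanB.
    by apply: eq_zp_mean => a; ring.
  rewrite -zp_meanD; apply: eq_zp_mean => a.
  rewrite /G [X in _ + X](_ : _ = ball n y a * zp_mean N (fun b => ball n y b * ((U a - U b) / nrm (a - b) ^+ 2))); last first.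
    by rewrite -zp_meanZ; apply: eq_zp_mean => b /=; rewrite -[LHS]mulrA.
  rewrite -mulrDr; have [/esym ay|ya] := eqVneq (residue y n) (residue a n); last first.
    by rewrite /ball (negbTE ya) !mul0r.
  congr (_ * _); rewrite mulrC -zp_meanZ -zp_meanB -zp_meanD; apply: eq_zp_mean => b.
  rewrite /W /ball; case: eqP => [/esym yb|/eqP yb].
    by have [-> _] := near_y mn yb; rewrite subrr !(mul0r, mulr0) mul1r subrr add0r.
  by rewrite (nrm_cong_sub ay) ?ay//; rewrite !mulr0n; ring.
rewrite (eq_zp_mean _ E).
rewrite -[X in _ - X](@mulfV _ (p%:R ^+ N)) ?gt_eqF ?exprn_gt0//.
rewrite -(zp_mean_ball R y (leqnn N)) [_ / nrm y]mulrC -!zp_meanZ -zp_meanB -zp_meanZ.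
apply: eq_zp_mean => a /=.
rewrite /ball; case: eqP => [ay|nay]; first by rewrite mulr1n; ring.
by case: eqP => [/(residue_eq_le nN)//|_]; rewrite !mulr0n; ring.
Qed.

(** Subtracting the averaged equation on the ball from the equation at s cancels the unknown
    integral of [W n * U]. What remains is (H + p^n) times the gap, with H >= 0 the mean of [W n],
    and it equals rho times e^(U s)/|y| + p^n (1 - mass of the ball). This is nonnegative, and at
    most rho (p^(n+1) + p^n); dividing by p^n gives rho (p + 1). *)
Lemma truncated_gap n s : (m <= n < N)%N -> sphere n s ->
  0 <= U s - p%:R ^+ n * ball_sum U n <= rho * (p%:R + 1).
Proof.
move=> /andP[mn nN] Ss; have /andP[/eqP sy sy1] := Ss.
have [ds es] := near_y mn sy.
have sN : residue s N != residue y N.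
  by apply: contra sy1 => /eqP h; rewrite (residue_eq_le nN h).
have pn0 : 0 < p%:R ^+ n :> R by exact: exprn_gt0.
(* Inside the ball the kernel at s may be replaced by p^(2n): this is its value on the smaller ball,
   and on the sphere itself [U b = U s]. *)
have hs : zp_mean N (W n) * U s - zp_mean N (fun b => W n b * U b) +
    p%:R ^+ n ^+ 2 * (p%:R ^- n * U s - ball_sum U n) = rho * (expR (U s) / nrm y).
  have := HU => -[_ _ _ /(_ _ ds)]; rewrite (negbTE sN) mulr0n mulr0 subr0 es => <-.
  rewrite -(zp_mean_ball R y (ltnW nN)) [in X in X - _]mulrC [in X in _ * (X - _)]mulrC.
  rewrite -!zp_meanZ -!zp_meanB -zp_meanZ -zp_meanD; apply: eq_zp_mean => b.
  rewrite /W /ball; have [yb|yb] := eqVneq (residue y n) (residue b n); last first.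
    rewrite -(nrm_cong_sub (esym sy) yb); rewrite !mulr0n; ring.
  have [-> _] := near_y mn (esym yb).
  have [yb1|yb1] := eqVneq (residue y n.+1) (residue b n.+1).
    rewrite (nrm_val (n := n) (a := s - b)); first by rewrite mulr1n exprVn invrK; ring.
      by apply/eqP; rewrite residue_subr_eq0 sy yb.
    by rewrite residue_subr_eq0 -yb1.
  have -> : U b = U s.
    apply: (@truncated_sphere n); rewrite ?mn//.
    by rewrite /sphere yb eqxx/= eq_sym.
  by rewrite mulr1n; ring.
have hb := ball_equation (n := n) (ltac:(by rewrite mn ltnW)).
have key : (zp_mean N (W n) + p%:R ^+ n) * (U s - p%:R ^+ n * ball_sum U n) =
    rho * (expR (U s) / nrm y + p%:R ^+ n * (1 - ball_sum (expR \o U) n / nrm y)).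
  transitivity (rho * (expR (U s) / nrm y) - p%:R ^+ n * (rho * (ball_sum (expR \o U) n / nrm y - 1))).
    by rewrite -hs -hb; field; rewrite gt_eqF.
  by ring.
have H0 : 0 <= zp_mean N (W n) by exact: zp_mean_ge0.
have /andP[M0 M1] := mass_le1 mn.
have e1 : expR (U s) / nrm y <= p%:R ^+ n.+1.
  have := @truncated_exp_le n.+1 s; rewrite es ler_pdivrMl ?exprn_gt0// mulr1.
  by apply => //; rewrite nN leqW.
have e0 : 0 <= expR (U s) / nrm y by rewrite divr_ge0 ?expR_ge0 ?nrm_ge0.
have HP : 0 < zp_mean N (W n) + p%:R ^+ n by rewrite ltr_pwDr.
have t0 : 0 <= U s - p%:R ^+ n * ball_sum U n.
  rewrite -(pmulr_rge0 _ HP) key; apply: mulr_ge0; first exact: ltW.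
  by apply: addr_ge0 => //; apply: mulr_ge0; [exact: ltW|rewrite subr_ge0].
rewrite t0/= -(ler_pM2l pn0).
apply: (@le_trans _ _ ((zp_mean N (W n) + p%:R ^+ n) * (U s - p%:R ^+ n * ball_sum U n))).
  by rewrite ler_wpM2r// lerDr.
rewrite key mulrCA ler_pM2l// [leRHS]mulrDr mulr1 -exprSr lerD// -[leRHS]mulr1.
by rewrite ler_pM2l// gerBl.
Qed.

Lemma truncated_step n s : (m <= n < N)%N -> sphere n s ->
  p%:R ^+ n.+1 * ball_sum U n.+1 = p%:R ^+ n * ball_sum U n
    - (p%:R - 1) * (U s - p%:R ^+ n * ball_sum U n).
Proof.
move=> mnN Ss; have /andP[mn nN] := mnN.
rewrite [X in p%:R ^+ n * X](@ball_sum_rec U n s)//; last first.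
  by move=> b Sb; exact: truncated_sphere Sb Ss.
have -> : p%:R ^- n.+1 = p%:R ^- n / p%:R :> R by rewrite exprSr invfM mulrC.
rewrite exprSr; field; rewrite !gt_eqF ?exprn_gt0//.
Qed.

Let C1 := rho * (p%:R + 1).
Definition truncated_bound := ln (p%:R ^+ m.+1 : R) + C1.
Local Notation K := truncated_bound.

Let C1_ge0 : 0 <= C1. Proof. by rewrite mulr_ge0 ?addr_ge0 ?ltW. Qed.

(** The means decrease by [truncated_step], as the gap is nonnegative. The first one is at most the
    value on the sphere of index m, which is bounded through the mass of a class modulo p^(m+1). *)
Let ball_sum_le n : (m < N)%N -> (m <= n <= N)%N -> p%:R ^+ n * ball_sum U n <= ln (p%:R ^+ m.+1).
Proof.
move=> mN' /andP[mn]; rewrite -(subnKC mn); elim: (n - m)%N => [_|k IH kN].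
  have S := sphere_shift m; set s := y + _ in S.
  have mmN : (m <= m < N)%N by rewrite leqnn.
  have /andP[+ _] := truncated_gap mmN S; rewrite addn0 subr_ge0 => /le_trans; apply.
  have /andP[/eqP s1 s2] := S; have [ds _] := near_y (leqnn m) s1.
  rewrite -[leLHS]expRK ler_ln ?posrE ?expR_gt0 ?exprn_gt0//.
  have := @truncated_exp_le m.+1 s; rewrite ler_pdivrMl ?exprn_gt0// mulr1.
  move=> /(_ _ ds s2) h; apply: le_trans (h _); last by rewrite leqnSn.
  rewrite ler_pdivlMr; last by rewrite nrm_gt0//; apply: contraTneq ds => ->; rewrite /dom /= mod0z eqxx.
  by rewrite -[leRHS]mulr1 ler_pM2l ?expR_gt0// nrm_le1.
rewrite addnS in kN *.
have mkN : (m <= m + k < N)%N by rewrite leq_addr.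
have S := sphere_shift (m + k).
rewrite (truncated_step mkN S); have /andP[g0 _] := truncated_gap mkN S.
apply: le_trans (IH (ltnW kN)); rewrite gerBl mulr_ge0// subr_ge0 ltW//.
Qed.

(** Three regions: on the class of y modulo p^N the value is the last mean itself; on a sphere
    around y it is a mean plus the gap; farther away the mass of a class modulo p^m bounds e^U. *)
Lemma truncated_le a : (m < N)%N -> dom a -> U a <= K.
Proof.
move=> mN' da; have [ayN|ayN] := eqVneq (residue a N) (residue y N).
  have := @ball_sum_le N mN' (ltac:(by rewrite leqnn mN)).
  rewrite /ball_sum (@zp_mean_ball_cst _ _ _ _ _ _ U)//; last first.
    by move=> b yb; exact: U_level.
  rewrite mulVKf ?gt_eqF ?exprn_gt0// -(U_level ayN) /K => /le_trans; apply.
  by rewrite lerDl.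
have [aym|aym] := eqVneq (residue a m) (residue y m).
  have [k /andP[mk kN] S] := sphere_ex mN aym ayN.
  have mkN : (m <= k < N)%N by rewrite mk.
  have /andP[_] := truncated_gap mkN S; rewrite lerBlDr => /le_trans; apply.
  rewrite /K addrC lerD2r; apply: ball_sum_le => //; by rewrite mk ltnW.
have := @truncated_exp_le m a (ltac:(by rewrite leqnn mN)) da aym.
rewrite ler_pdivrMl ?exprn_gt0// mulr1 => h.
have : expR (U a) <= p%:R ^+ m.+1.
  apply: (@le_trans _ _ (p%:R ^+ m)); last by rewrite ler_eXn2l.
  apply: le_trans h; rewrite ler_pdivlMr; last first.
    by rewrite nrm_gt0//; apply: contraTneq da => ->; rewrite /dom /= mod0z eqxx.
  by rewrite -[leRHS]mulr1 ler_pM2l ?expR_gt0// nrm_le1.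
rewrite -[p%:R ^+ m.+1]lnK ?posrE ?exprn_gt0// ler_expR => /le_trans; apply.
by rewrite /K lerDl.
Qed.

Lemma truncated_exp_ball_le n : (m < N)%N -> (m <= n <= N)%N ->
  ball_sum (expR \o U) n <= p%:R ^- n * expR K.
Proof.
move=> mN' /andP[mn nN]; rewrite -(zp_mean_ball R y nN) mulrC -zp_meanZ.
apply: le_zp_mean => b; rewrite /ball; case: eqP => [yb|_] /=.
  rewrite mul1r mulr1 ler_expR truncated_le//.
  by have [] := near_y mn (esym yb).
by rewrite mul0r mulr0.
Qed.

(* A Harnack inequality: at a point where [U] is not too negative, the equation
   bounds the mean of [K - U]. *)
Lemma truncated_mean_le n : (m <= n <= N)%N -> (m < N)%N ->
  p%:R ^- n * expR K / nrm y <= 1 / 2 ->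
  zp_mean N (fun a => F a * (K - U a)) <=
    (K + ln (p%:R ^+ m * 4)) * p%:R ^+ n ^+ 2 + rho * (expR K * p%:R ^+ m).
Proof.
move=> mnN mN' small; have /andP[mn nN] := mnN.
(* Otherwise the total mass would be at most 1/2 from the ball and 1/4 from its complement. *)
have [a [da ay ea]] : exists a, [/\ dom a, residue a n != residue y n &
    1 / 4 <= expR (U a) / nrm a].
  apply: contrapT => no.
  suff : (1 : R) <= 1 / 2 + 1 / 4 by lra.
  rewrite -{1}mass1; apply: (@le_trans _ _ (ball_sum (expR \o U) n / nrm y + 1 / 4)).
    rewrite mulrC -zp_meanZ -[1 / 4](zp_mean_cst p_pr N) -zp_meanD.
    apply: le_zp_mean => b; rewrite /ball /=.
    have [yb|yb] := eqVneq (residue y n) (residue b n).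
      by have [-> ->] := near_y mn (esym yb); rewrite !mul1r mulrC; lra.
    rewrite mul0r mulr0 add0r; have [db|_] := boolP (dom b); last by rewrite mul0r; lra.
    rewrite mul1r leNgt; apply/negP => h; apply: no; exists b; split => //.
      by rewrite eq_sym.
    by move/ltW: h; rewrite mulr1n !mul1r.
  rewrite lerD2r (le_trans _ small)// ler_pM2r ?truncated_exp_ball_le//.
  by rewrite invr_gt0 nrm_gt0//; apply: contraNneq ym => ->; rewrite /= mod0z.
have na : p%:R ^- m < nrm a by rewrite ltNge nrm_le.
have na0 : 0 < nrm a by apply: lt_trans na.
have UaK := truncated_le mN' da.
have Ua : - ln (p%:R ^+ m * 4) <= U a.
  rewrite -lnV ?posrE ?mulr_gt0 ?exprn_gt0//.
  rewrite -[leRHS]expRK ler_ln ?posrE ?expR_gt0 ?invr_gt0 ?mulr_gt0 ?exprn_gt0//.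
  move: ea; rewrite ler_pdivlMr// => ea; apply: le_trans ea.
  by rewrite invfM mulrC mul1r ler_pM2l ?ltW//; lra.
have pn1 : 1 <= p%:R ^+ n :> R by rewrite exprn_ege1// ltW.
apply: (@le_trans _ _ ((K - U a) * p%:R ^+ n ^+ 2 + rho * (expR (U a) / nrm a))).
  have aN : residue a N != residue y N.
    by apply: contra ay => /eqP h; rewrite (residue_eq_le nN h).
  have := HU => -[_ _ _ /(_ _ da)]; rewrite (negbTE aN) mulr0n mulr0 subr0 => <-.
  rewrite -[X in _ <= X + _](zp_mean_cst p_pr N) -zp_meanD; apply: le_zp_mean => b.
  have KUa : 0 <= K - U a by rewrite subr_ge0.
  have [db|_] := boolP (dom b); last first.
    by rewrite !mul0r addr0 mulr_ge0 ?sqr_ge0.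
  rewrite !mul1r; have [ab|ab] := eqVneq (residue a n) (residue b n).
    have [_ _ _ <-] := truncated_loc_cst mnN da ay ab.
    by rewrite subrr mul0r addr0 ler_peMr// exprn_ege1.
  have nab : p%:R ^- n < nrm (a - b) by rewrite ltNge nrm_close.
  have nab0 : 0 < nrm (a - b) by exact: lt_trans nab.
  have KUb : 0 <= K - U b by rewrite subr_ge0 truncated_le.
  (* The kernel t lies between 1 and p^(2n): the lower bound replaces [K - U b] by t times itself,
     which the equation at a controls, and the upper bound limits the remaining t (K - U a). *)
  set t := (nrm (a - b) ^+ 2)^-1.
  have t1 : 1 <= t by rewrite invf_ge1 ?exprn_gt0// exprn_ile1 ?nrm_le1 ?ltW.
  have t2 : t <= p%:R ^+ n ^+ 2.
    rewrite -[leRHS]invrK lef_pV2 ?posrE ?invr_gt0 ?exprn_gt0//.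
    by rewrite -exprVn lerXn2r ?nnegrE ?ltW.
  apply: (@le_trans _ _ (t * (K - U b))); first by rewrite ler_peMl.
  rewrite [_ / _]mulrC -/t.
  have -> : t * (K - U b) = (K - U a) * t + t * (U a - U b) by ring.
  by rewrite lerD2r ler_wpM2l.
apply: lerD.
  by rewrite ler_wpM2r ?sqr_ge0// lerD2l lerNl.
rewrite ler_pM2l// ler_pM ?expR_ge0 ?invr_ge0 ?(ltW na0)// ?ler_expR//.
by rewrite -[leRHS]invrK lef_pV2 ?posrE ?invr_gt0 ?exprn_gt0// ltW.
Qed.

(** Turns an integral off the ball into a sum over p^n classes for every N >= n, so that limits in N
    pass through it term by term. *)
Lemma truncated_level n (f : Zp -> R -> R) : (m <= n <= N)%N ->
  (forall a b x, residue a n = residue b n -> nrm a = nrm b -> f a x = f b x) ->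
  level n (fun b => F b * ((1 - ball n y b) * f b (U b))).
Proof.
move=> mnN fP a b ab; have /andP[mn nN] := mnN.
rewrite /ball -ab /dom (residue_eq_le mn ab) -/(dom b).
have [yb|yb] := eqVneq (residue y n) (residue a n).
  by rewrite subrr !(mul0r, mulr0).
have [db|_] := boolP (dom b); last by rewrite !mul0r.
have da : dom a by rewrite /dom (residue_eq_le mn ab).
have ay : residue a n != residue y n by rewrite eq_sym.
by have [_ e _ ->] := truncated_loc_cst mnN da ay ab; rewrite (fP _ _ _ ab e).
Qed.

Lemma truncated_mass n : (m <= n <= N)%N ->
  zp_mean n (fun b => F b * ((1 - ball n y b) * (expR (U b) / nrm b)))
    + ball_sum (expR \o U) n / nrm y = 1.
Proof.
move=> mnN; have /andP[mn nN] := mnN; rewrite -[RHS]mass1.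
rewrite -(zp_mean_refine nN); last first.
  apply: (@truncated_level _ (fun b x => expR x / nrm b)) => // a b x _ -> //.
rewrite mulrC -zp_meanZ -zp_meanD; apply: eq_zp_mean => b /=.
rewrite /ball; have [yb|yb] := eqVneq (residue y n) (residue b n).
  by have [-> ->] := near_y mn (esym yb); rewrite subrr mulr1n; ring.
by rewrite mulr0n; ring.
Qed.

Lemma truncated_equation n a : (m <= n <= N)%N -> dom a ->
  residue a n != residue y n ->
  zp_mean n (fun b => F b * ((1 - ball n y b) * ((U a - U b) / nrm (a - b) ^+ 2)))
    + (p%:R ^- n * U a - ball_sum U n) / nrm (a - y) ^+ 2 =
  rho * (expR (U a) / nrm a).
Proof.
move=> mnN da ay; have /andP[mn nN] := mnN.
have aN : residue a N != residue y N.
  by apply: contra ay => /eqP h; rewrite (residue_eq_le nN h).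
have := HU => -[_ _ _ /(_ _ da)]; rewrite (negbTE aN) mulr0n mulr0 subr0 => <-.
rewrite -(zp_mean_refine nN); last first.
  (* |a - b| is not constant on the class of a, but [U a - U b] is 0 there; setting the integrand to
     0 on that class gives it level n. *)
  pose f b x := if residue a n == residue b n then 0 else (U a - x) / nrm (a - b) ^+ 2.
  have -> : (fun b => F b * ((1 - ball n y b) * ((U a - U b) / nrm (a - b) ^+ 2))) =
            (fun b => F b * ((1 - ball n y b) * f b (U b))).
    apply/funext => b; rewrite /f; case: eqP => // ab.
    by have [_ _ _ <-] := truncated_loc_cst mnN da ay ab; rewrite subrr mul0r.
  apply: truncated_level => // b c x bc _; rewrite /f -bc.
  case: eqVneq => // ab.
  by rewrite [nrm (a - b)]nrmBC (nrm_cong_sub bc) 1?eq_sym// nrmBC.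
rewrite -(zp_mean_ball R y nN) mulrC [in X in _ * (X - _)]mulrC -!zp_meanZ -zp_meanB -zp_meanZ -zp_meanD.
apply: eq_zp_mean => b; rewrite /ball.
have [yb|yb] := eqVneq (residue y n) (residue b n); last by rewrite mulr0n; ring.
have [-> _] := near_y mn (esym yb).
rewrite [nrm (a - y)](_ : _ = nrm (a - b)); first by rewrite mulr1n; ring.
by rewrite nrmBC (nrm_cong_sub yb) 1?eq_sym// nrmBC.
Qed.

End bounds.

(** The data that survive the limit: u off y, with [A n] and [M n] standing for the dx-integrals of
    u and e^u over the ball of radius p^-n around y. The value [u y] is left free. *)
Definition mean_field_profile (u : Zp -> R) (A M : nat -> R) := [/\
  forall a b, dom a -> a != y -> nrm a = nrm b -> nrm (a - y) = nrm (b - y) ->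
    u a = u b,
  forall n a, (m <= n)%N -> dom a -> residue a n != residue y n ->
    zp_mean n (fun b => F b * ((1 - ball n y b) * ((u a - u b) / nrm (a - b) ^+ 2)))
      + (p%:R ^- n * u a - A n) / nrm (a - y) ^+ 2 = rho * (expR (u a) / nrm a),
  forall n, (m <= n)%N ->
    zp_mean n (fun b => F b * ((1 - ball n y b) * (expR (u b) / nrm b)))
      + M n / nrm y = 1,
  forall n, (m <= n)%N ->
    A n = (p%:R ^- n - p%:R ^- n.+1) * u (y + (p ^ n)%:R) + A n.+1 /\
    M n = (p%:R ^- n - p%:R ^- n.+1) * expR (u (y + (p ^ n)%:R)) + M n.+1 &
  exists C : R, forall n, (m <= n)%N ->
    [/\ 0 <= u (y + (p ^ n)%:R) - p%:R ^+ n * A n <= C, 0 <= M n <= p%:R ^- n * C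
      & p%:R ^+ n * A n <= C]].

Lemma cvg_zp_mean n (G : set_system nat) (f : nat -> Zp -> R) (g : Zp -> R) :
  ProperFilter G -> (forall b, f ^~ b @ G --> g b) ->
  (fun N => zp_mean n (f N)) @ G --> zp_mean n g.
Proof.
move=> GF fg; apply: cvgM; first exact: cvg_cst.
by apply: cvg_sum_fin => c _; exact: fg.
Qed.

Lemma mean_field_profile_ex : exists u A M, mean_field_profile u A M.
Proof.
have exU N : exists U, (m <= N)%N -> mean_field_level N U.
  have [mN|_] := boolP (m <= N)%N; last by exists (fun=> 0).
  by have [U HU] := mean_field_level_ex mN; exists U.
have [U HU] := choice exU; set K := truncated_bound.
have y0 : 0 < nrm y by rewrite nrm_gt0//; apply: contraNneq ym => ->; rewrite /= mod0z.
(* A ball around y carrying at most half of the mass, with n1 independent of N, as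
   [truncated_mean_le] requires. *)
have [n1 mn1 small] : exists2 n1, (m < n1)%N & p%:R ^- n1 * expR K / nrm y <= 1 / 2.
  have : (fun n => (p%:R^-1 : R) ^+ n * (expR K / nrm y)) @ \oo --> 0 * (expR K / nrm y).
    apply: cvgM; last exact: cvg_cst.
    by apply: cvg_expr; rewrite ger0_norm ?invr_ge0 ?ltW// invf_lt1.
  rewrite mul0r => /cvgr_le /(_ (1 / 2)) h.
  have {}h := h (ltac:(lra)).
  have [n [h1 h2]] := @filter_ex _ \oo _ _ (filterI h (nbhs_infty_ge m.+1)).
  by exists n => //; rewrite -exprVn -mulrA.
pose C := (K + ln (p%:R ^+ m * 4)) * p%:R ^+ n1 ^+ 2 + rho * (expR K * p%:R ^+ m).
have meanC N : (n1 <= N)%N -> zp_mean N (fun a => F a * (K - U N a)) <= C.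
  move=> nN; have mN := leq_trans mn1 nN.
  by apply: truncated_mean_le => //; [exact: ltnW|exact: HU (ltnW _)|rewrite (ltnW mn1)].
have KU N a : (n1 <= N)%N -> dom a -> U N a <= K.
  move=> nN; have mN := leq_trans mn1 nN; exact: truncated_le (ltnW mN) (HU _ (ltnW mN)) _ mN.
(* [K - U N] is nonnegative on F, has mean at most C and is constant on a class of mass p^-n, hence
   is at most p^n C there. *)
have boundU n N a : (m <= n)%N -> (n <= N)%N -> (n1 <= N)%N -> dom a ->
    residue a n != residue y n -> K - p%:R ^+ n * C <= U N a <= K.
  move=> mn nN n1N da ay; rewrite KU// andbT lerBlDr -lerBlDl -ler_pdivrMl ?exprn_gt0//.
  apply: le_trans (meanC _ n1N).
  have mN := leq_trans mn nN; have mnN : (m <= n <= N)%N by rewrite mn.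
  rewrite -(@zp_mean_ball_cst _ p_pr R n N a (fun b => K - U N b))//.
    apply: le_zp_mean => b; rewrite /ball; case: eqP => [ab|_].
      by have [-> _ _ _] := truncated_loc_cst (HU _ mN) mnN da ay ab.
    rewrite mul0r; have [db|_] := boolP (dom b); last by rewrite mul0r.
    by rewrite mul1r subr_ge0 KU.
  by move=> b ab; have [_ _ _ <-] := truncated_loc_cst (HU _ mN) mnN da ay ab.
have boundA n N : (m <= n)%N -> (n <= N)%N -> (n1 <= N)%N ->
    p%:R ^- n * K - C <= ball_sum N (U N) n <= p%:R ^- n * K.
  move=> mn nN n1N; rewrite -(zp_mean_ball R y nN) mulrC -zp_meanZ.
  apply/andP; split.
    rewrite lerBlDr -lerBlDl; apply: le_trans (meanC _ n1N).
    rewrite -zp_meanB; apply: le_zp_mean => b; rewrite /ball.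
    case: eqP => [/esym/(near_y mn)[-> _]|_]; first by rewrite mulr1n; lra.
    rewrite !mul0r mulr0 subr0; have [db|_] := boolP (dom b); last by rewrite mul0r.
    by rewrite mul1r subr_ge0 KU.
  apply: le_zp_mean => b; rewrite /ball.
  case: eqP => [/esym/(near_y mn)[db _]|_]; last by rewrite mul0r mulr0.
  by rewrite mul1r mulr1 KU.
have boundM n N : (m <= n)%N -> (n <= N)%N -> (n1 <= N)%N ->
    0 <= ball_sum N (expR \o U N) n <= p%:R ^- n * expR K.
  move=> mn nN n1N; have mN := leq_trans mn1 n1N.
  rewrite (truncated_exp_ball_le (ltnW mN) (HU _ (ltnW mN)))// ?mn// andbT.
  by apply: zp_mean_ge0 => a; rewrite mulr_ge0 ?ball_ge0 ?expR_ge0.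
have [G GU oG] := ultrafilter_eventually.
have far a : a != y -> exists2 n, (m <= n)%N & residue a n != residue y n.
  rewrite -subr_eq0 => /residue_neq0[k]; rewrite residue_subr_eq0 => ak.
  exists (maxn m k.+1); first by rewrite leq_maxl.
  by apply: contra ak => /eqP/(residue_eq_le (leq_maxr m k.+1)) ->.
have exu a : exists x : R, dom a -> a != y -> (fun N => U N a) @ G --> x.
  have [da|_] := boolP (dom a); last by exists 0.
  have [_|/far[n mn an]] := eqVneq a y; first by exists 0.
  have [x Hx] : exists x : R, (fun N => U N a) @ G --> x; last by exists x.
  apply: (ultra_bounded_cvg (a := K - p%:R ^+ n * C) (b := K)) => //.
  near=> N; apply: boundU => //; near: N; exact: nbhs_infty_ge.
have [u0 Hu0] := choice exu.
have exA n : exists x : R, (m <= n)%N -> (fun N => ball_sum N (U N) n) @ G --> x.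
  have [mn|_] := boolP (m <= n)%N; last by exists 0.
  have [x Hx] : exists x : R, (fun N => ball_sum N (U N) n) @ G --> x; last by exists x.
  apply: (ultra_bounded_cvg (a := p%:R ^- n * K - C) (b := p%:R ^- n * K)) => //.
  near=> N; apply: boundA => //; near: N; exact: nbhs_infty_ge.
have [A HA] := choice exA.
have exM n : exists x : R, (m <= n)%N -> (fun N => ball_sum N (expR \o U N) n) @ G --> x.
  have [mn|_] := boolP (m <= n)%N; last by exists 0.
  have [x Hx] : exists x : R, (fun N => ball_sum N (expR \o U N) n) @ G --> x; last by exists x.
  apply: (ultra_bounded_cvg (a := 0) (b := p%:R ^- n * expR K)) => //.
  near=> N; apply: boundM => //; near: N; exact: nbhs_infty_ge.
have [M HM] := choice exM.
have ge_near k : \forall N \near G, (k <= N)%N by apply: oG; exact: nbhs_infty_ge.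
have near_unique (f g : nat -> R) (x z : R) : (\forall N \near G, f N = g N) ->
    f @ G --> x -> g @ G --> z -> x = z.
  move=> fg fx gz; apply: (@cvg_unique _ _ (g @ G)) => //.
  by apply: cvg_trans fx; apply: near_eq_cvg; apply: filterS fg => N ->.
have u_cvg n a : (m <= n)%N -> dom a -> residue a n != residue y n ->
    (fun N => U N a) @ G --> u0 a.
  by move=> mn da ay; apply: Hu0 => //; apply: contraNneq ay => ->.
have s_cvg n : (m <= n)%N -> (fun N => U N (y + (p ^ n)%:R)) @ G --> u0 (y + (p ^ n)%:R).
  move=> mn; have /andP[/eqP s1 s2] := sphere_shift n.
  by apply: (u_cvg n.+1) => //; [exact: leqW|have [] := near_y mn s1].
(* Each clause holds for [U N] once N is large; its two sides converge along [G], and uniqueness of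
   limits transfers it. *)
exists u0, A, M; split.
- move=> a b da ay ab aby; have [n mn an] := far _ ay.
  have bn : residue b n != residue y n by rewrite -(nrm_eq_residue _ aby).
  have db : dom b by rewrite /dom -(nrm_eq_residue0 _ ab).
  apply: (near_unique _ _ _ _ _ (u_cvg _ _ mn da an) (u_cvg _ _ mn db bn)).
  near=> N; have nN : (n <= N)%N by near: N; exact: ge_near.
  have [_ h _ _] := HU N (leq_trans mn nN); apply: h => //.
  by apply: contra an => /eqP e; rewrite (residue_eq_le nN e).
- move=> n a mn da ay.
  apply: (near_unique (fun N => zp_mean n (fun b => F b * ((1 - ball n y b) * ((U N a - U N b) / nrm (a - b) ^+ 2)))
      + (p%:R ^- n * U N a - ball_sum N (U N) n) / nrm (a - y) ^+ 2) (fun N => rho * (expR (U N a) / nrm a))).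
  + near=> N; have nN : (n <= N)%N by near: N; exact: ge_near.
    by apply: truncated_equation; rewrite ?mn//; exact: HU (leq_trans mn nN).
  + apply: cvgD.
      apply: cvg_zp_mean => b; have [db|_] := boolP (dom b); last first.
        by rewrite mul0r; under eq_fun do rewrite mul0r; exact: cvg_cst.
      rewrite /ball; have [yb|yb] := eqVneq (residue y n) (residue b n).
        rewrite subrr mul0r mulr0; under eq_fun do rewrite mul0r mulr0; exact: cvg_cst.
      apply: cvgM; first exact: cvg_cst.
      apply: cvgM; first exact: cvg_cst.
      apply: cvgM; last exact: cvg_cst.
      by apply: cvgB; apply: (u_cvg n) => //; rewrite eq_sym.
    apply: cvgM; last exact: cvg_cst.
    apply: cvgB; last exact: HA.
    by apply: cvgM; [exact: cvg_cst|exact: u_cvg ay].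
  + apply: cvgM; first exact: cvg_cst.
    apply: cvgM; last exact: cvg_cst.
    by apply: continuous_cvg; [exact: continuous_expR|exact: u_cvg ay].
- move=> n mn.
  apply: (near_unique (fun N => zp_mean n (fun b => F b * ((1 - ball n y b) * (expR (U N b) / nrm b)))
      + ball_sum N (expR \o U N) n / nrm y) (fun=> 1)).
  + near=> N; have nN : (n <= N)%N by near: N; exact: ge_near.
    by apply: truncated_mass; rewrite ?mn//; exact: HU (leq_trans mn nN).
  + apply: cvgD.
      apply: cvg_zp_mean => b; have [db|_] := boolP (dom b); last first.
        by rewrite mul0r; under eq_fun do rewrite mul0r; exact: cvg_cst.
      rewrite /ball; have [yb|yb] := eqVneq (residue y n) (residue b n).
        rewrite subrr mul0r mulr0; under eq_fun do rewrite mul0r mulr0; exact: cvg_cst.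
      apply: cvgM; first exact: cvg_cst.
      apply: cvgM; first exact: cvg_cst.
      apply: cvgM; last exact: cvg_cst.
      apply: continuous_cvg; first exact: continuous_expR.
      by apply: (u_cvg n) => //; rewrite eq_sym.
    by apply: cvgM; [exact: HM|exact: cvg_cst].
  + exact: cvg_cst.
- move=> n mn; have S := sphere_shift n.
  have su N : (n < N)%N -> forall b, sphere n b -> U N b = U N (y + (p ^ n)%:R).
    move=> nN b Sb; have mN := leq_trans mn (ltnW nN).
    by apply: (truncated_sphere (HU _ mN)) Sb S; rewrite mn.
  split.
  + apply: (near_unique (fun N => ball_sum N (U N) n)
      (fun N => (p%:R ^- n - p%:R ^- n.+1) * U N (y + (p ^ n)%:R) + ball_sum N (U N) n.+1)).
    * near=> N; have nN : (n < N)%N by near: N; exact: ge_near.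
      by apply: ball_sum_rec => // b Sb; exact: su.
    * exact: HA.
    * apply: cvgD; last exact: HA (leqW mn).
      by apply: cvgM; [exact: cvg_cst|exact: s_cvg].
  + apply: (near_unique (fun N => ball_sum N (expR \o U N) n)
      (fun N => (p%:R ^- n - p%:R ^- n.+1) * expR (U N (y + (p ^ n)%:R))
         + ball_sum N (expR \o U N) n.+1)).
    * near=> N; have nN : (n < N)%N by near: N; exact: ge_near.
      by apply: ball_sum_rec => // b Sb /=; rewrite (su N).
    * exact: HM.
    * apply: cvgD; last exact: HM (leqW mn).
      apply: cvgM; first exact: cvg_cst.
      by apply: continuous_cvg; [exact: continuous_expR|exact: s_cvg].
(* The three entries bound the gap, the mass [p%:R ^+ n * M n] and the mean [p%:R ^+ n * A n]
   respectively. *)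
exists (Num.max (rho * (p%:R + 1)) (Num.max (expR K) K)) => n mn.
have S := sphere_shift n.
have gap_cvg : (fun N => U N (y + (p ^ n)%:R) - p%:R ^+ n * ball_sum N (U N) n) @ G -->
    u0 (y + (p ^ n)%:R) - p%:R ^+ n * A n.
  by apply: cvgB; [exact: s_cvg|apply: cvgM; [exact: cvg_cst|exact: HA]].
have gapN : \forall N \near G, 0 <= U N (y + (p ^ n)%:R) - p%:R ^+ n * ball_sum N (U N) n <= rho * (p%:R + 1).
  near=> N; have nN : (n < N)%N by near: N; exact: ge_near.
  have mN := leq_trans mn (ltnW nN).
  by apply: (truncated_gap (HU _ mN)) => //; rewrite mn.
split.
- apply/andP; split.
    by apply: (cvgr_to_ge gap_cvg); apply: filterS gapN => N /andP[].
  rewrite le_max; apply/orP; left.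
  by apply: (cvgr_to_le gap_cvg); apply: filterS gapN => N /andP[].
- have hM : \forall N \near G, 0 <= ball_sum N (expR \o U N) n <= p%:R ^- n * expR K.
    near=> N; apply: boundM => //; near: N; exact: ge_near.
  apply/andP; split.
    by apply: (cvgr_to_ge (HM _ mn)); apply: filterS hM => N /andP[].
  apply: (@le_trans _ _ (p%:R ^- n * expR K)).
    by apply: (cvgr_to_le (HM _ mn)); apply: filterS hM => N /andP[].
  by rewrite ler_pM2l// !le_max lexx orbT.
- apply: (@le_trans _ _ K); last by rewrite !le_max lexx !orbT.
  rewrite -ler_pdivlMl ?exprn_gt0//; apply: (cvgr_to_le (HA _ mn)).
  near=> N; have /andP[_] : p%:R ^- n * K - C <= ball_sum N (U N) n <= p%:R ^- n * K.
    apply: boundA => //; near: N; exact: ge_near.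
  by [].
Unshelve. all: end_near. Qed.

End truncated.

(** * Haar measure and integration *)

Lemma Rintegral_bigsetU d (T : measurableType d) (R : realType)
    (nu : {measure set T -> \bar R}) (I : eqType) (s : seq I) (E : I -> set T)
    (f : T -> R) :
  uniq s -> trivIset [set` s] E -> (forall i, measurable (E i)) ->
  (forall i, i \in s -> nu.-integrable (E i) (EFin \o f)) ->
  nu.-integrable (\big[setU/set0]_(i <- s) E i) (EFin \o f) /\
  \int[nu]_(x in \big[setU/set0]_(i <- s) E i) f x =
    \sum_(i <- s) \int[nu]_(x in E i) f x.
Proof.
move=> us tE mE fE.
have mf : measurable_fun (\big[setU/set0]_(i <- s) E i) (EFin \o f).
  move: fE; elim: s {us tE} => [|i s IH] fE.
    by rewrite big_nil; exact: measurable_fun_set0.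
  rewrite big_cons measurable_funU//; last exact: bigsetU_measurable.
  split; first by apply: (measurable_int nu); apply: fE; rewrite mem_head.
  by apply: IH => j js; apply: fE; rewrite inE js orbT.
split.
  apply/integrableP; split => //.
  rewrite ge0_integral_bigsetU//; last exact: measurableT_comp.
  rewrite big_seq; apply: lte_sum_pinfty => i /fE.
  by move=> /integrableP[].
rewrite /Rintegral integral_bigsetU_EFin// big_seq [in RHS]big_seq.
rewrite -sum_fine// => i /fE fi.
exact: (integrable_fin_num (mE i) fi).
Qed.

(** * Haar measure of residue classes, spheres and points *)

Section haar.
Variables (p : nat) (p_pr : prime p) (R : realType).
Local Notation Zp := (padic_int p_pr).
Local Notation Qp := (padic p_pr).
Local Notation ofint := (@padic_of_int p p_pr).
Implicit Types a b y : Zp.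

Let p1 : 1 < p%:R :> R. Proof. by rewrite ltr1n prime_gt1. Qed.
Let p0 : 0 < p%:R :> R. Proof. by rewrite ltr0n prime_gt0. Qed.

Definition cyl n a : set Qp := ofint @` [set b | residue b n = residue a n].

Lemma cylE n a b : cyl n a (ofint b) <-> residue b n = residue a n.
Proof.
split=> [[b' h /padic_of_int_inj <-]//|h]; by exists b.
Qed.

Lemma padic_open_cyl n a : padic_open (cyl n a).
Proof.
move=> _ [b ba <-]; have pq : 0 < p%:R :> rat by rewrite ltr0n prime_gt0.
exists (p%:R ^- n); first by rewrite invr_gt0 exprn_gt0.
move=> z /= zb; have [|c zc] := @padic_integersE _ p_pr rat (z - ofint b).
  apply: (le_trans (ltW zb)); rewrite invf_le1 ?exprn_gt0//.
  by rewrite exprn_ege1// ler1n prime_gt0.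
have -> : z = ofint (c + b) by rewrite padic_of_intD -zc subrK.
apply/cylE; rewrite -ba; apply/eqP.
by rewrite -(nrm_close rat) addrK /nrm -zc ltW.
Qed.

Lemma measurable_cyl n a : measurable (cyl n a).
Proof. by apply: measurable_padic_open; exact: padic_open_cyl. Qed.

Lemma cyl_sub n k a : (k <= n)%N -> cyl n a `<=` cyl k a.
Proof. by move=> kn _ [b h <-]; apply/cylE; exact: residue_eq_le kn h. Qed.

Lemma trivIset_cyl n (A : set 'I_(p ^ n)) : trivIset A (fun c => cyl n c%:R).
Proof.
move=> i j _ _ [x [[b hb <-] /cylE]]; rewrite hb => h.
by rewrite -(cell_nat p_pr i) -(cell_nat p_pr j); exact: cell_eq.
Qed.

Lemma bigsetU_cyl n (P : pred 'I_(p ^ n)) :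
  \big[setU/set0]_(c <- enum 'I_(p ^ n) | P c) cyl n c%:R =
  ofint @` [set a | P (cell n a)].
Proof.
apply/seteqP; split => [x|_ [a Pa <-]].
  rewrite -bigcup_seq_cond => -[c /= /andP[_ Pc]] [b hb <-]; exists b => //=.
  by rewrite (cell_eq hb) cell_nat.
rewrite -bigcup_seq_cond; exists (cell n a) => /=; first by rewrite mem_enum.
by apply/cylE; rewrite residue_cell.
Qed.

Variables (dx : {measure set Qp -> \bar R}) (dx_haar : is_haar dx).

(** Z_p is a disjoint union of p^n translates of one class, and has total mass 1. *)
Lemma haar_cyl n a : dx (cyl n a) = (p%:R ^- n)%:E.
Proof.
have [inv tot] := dx_haar.
have tr b : dx (cyl n b) = dx (cyl n 0%R).
  rewrite -(inv (ofint b) (cyl n 0%R))//; last exact: measurable_cyl.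
  congr (dx _); apply/seteqP; split => [_ [c cb <-]|_ [_ [c c0 <-] <-]].
    exists (ofint (c - b)); last by rewrite padic_of_intB addrC subrK.
    apply/cylE; rewrite [RHS]mod0z; apply/eqP.
    by rewrite residue_subr_eq0 cb.
  rewrite -padic_of_intD; apply/cylE; apply/eqP.
  rewrite -residue_subr_eq0 [b + c]addrC addrK.
  by move: c0 => /= ->; rewrite mod0z.
rewrite tr; have s1 : (\sum_(c < p ^ n) dx (cyl n 0%R) = 1)%E.
  rewrite -tot [in RHS](_ : padic_integers p p_pr = \big[setU/set0]_(c < p ^ n) cyl n c%:R).
    rewrite measure_semi_additive_ord//.
    - by apply: eq_bigr => c _; rewrite [RHS]tr.
    - by move=> c; exact: measurable_cyl.
    - exact: trivIset_cyl.
    - by apply: bigsetU_measurable => c _; exact: measurable_cyl.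
  rewrite -big_enum/= (@bigsetU_cyl n xpredT)/padic_integers; congr (ofint @` _).
  by apply/seteqP; split.
have v0 : (0 <= dx (cyl n 0%R))%E by exact: measure_ge0.
have fin : dx (cyl n 0%R) \is a fin_num.
  rewrite ge0_fin_numE//; apply: (@le_lt_trans _ _ 1%E); last exact: ltry.
  rewrite -tot; apply: le_measure; rewrite ?inE.
  - exact: measurable_cyl.
  - rewrite (_ : padic_integers p p_pr = cyl 0 0); first exact: measurable_cyl.
    apply/seteqP; split=> [_ [b _ <-]|_ [b _ <-]]; last by exists b.
    apply/cylE; by rewrite -(residue_mod b) -(residue_mod 0) expn0 !modz1.
  - by move=> _ [b _ <-]; exists b.
move: s1; rewrite -(fineK fin) sumEFin sumr_const card_ord => -[].
rewrite -[_ *+ _]mulr_natr natrX => h; congr (_%:E).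
by apply: (mulIf (lt0r_neq0 (exprn_gt0 n p0))); rewrite h mulVf// gt_eqF ?exprn_gt0.
Qed.

Lemma mult_measure_cst (A : set Qp) r : measurable A ->
  (forall x, A x -> padic_abs R x = r) ->
  mult_measure dx A = ((r^-1)%:E * dx A)%E.
Proof.
move=> mA Ar; rewrite /mult_measure -integral_cst//; apply: eq_integral => x.
by rewrite inE => /Ar ->.
Qed.

Variable y : Zp.

Definition sph n : set Qp := cyl n y `\` cyl n.+1 y.

Lemma measurable_sph n : measurable (sph n).
Proof. by apply: measurableD; exact: measurable_cyl. Qed.

Lemma haar_sph n : dx (sph n) = (p%:R ^- n - p%:R ^- n.+1)%:E.
Proof.
rewrite (measureD (measurable_cyl _ _) (measurable_cyl _ _)); last first.
  by apply: (@le_lt_trans _ _ (p%:R ^- n)%:E); rewrite ?ltry// -(haar_cyl n y).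
have -> : cyl n y `&` cyl n.+1 y = cyl n.+1 y by apply/setIidPr/cyl_sub.
by transitivity (dx (cyl n y) - dx (cyl n.+1 y))%E => //; rewrite !haar_cyl.
Qed.

Lemma measurable_padic_set1 : measurable [set ofint y].
Proof.
rewrite (_ : [set _] = \bigcap_n cyl n y).
  by apply: bigcapT_measurable => n; exact: measurable_cyl.
apply/seteqP; split=> [_ -> n _|x h]; first exact/cylE.
have [b _ bx] := h 0%N I; rewrite -bx; congr ofint.
by apply: pint_P => n; apply/cylE; rewrite bx; exact: h.
Qed.

Lemma haar_set1 : dx [set ofint y] = 0%E.
Proof.
apply/eqP; rewrite eq_le measure_ge0 andbT; apply/lee_addgt0Pr => e e0.
rewrite add0e.
have : (fun n => (p%:R^-1 : R) ^+ n) @ \oo --> 0.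
  by apply: cvg_expr; rewrite ger0_norm ?invr_ge0 ?ltW// invf_lt1.
move=> /cvgr_le /(_ e e0) h.
have [n /= hn] := @filter_ex _ \oo _ _ h.
apply: (@le_trans _ _ (dx (cyl n y))); last by rewrite haar_cyl -exprVn lee_fin.
apply: le_measure; rewrite ?inE; [exact: measurable_padic_set1|exact: measurable_cyl|].
by move=> _ ->; exact/cylE.
Qed.

Lemma cyl_sph n : cyl n y = [set ofint y] `|` \bigcup_k sph (n + k).
Proof.
apply/seteqP; split => [_ [b hb <-]|x [->|[k _ [h _]]]]; last 2 first.
- exact/cylE.
- by apply: cyl_sub h; rewrite leq_addr.
have [->|/eqP by0] := eqVneq b y; [by left|right].
have [N bN] : exists N, residue b N != residue y N.
  apply: contrapT => h; apply: by0; apply: pint_P => N; apply/eqP/negP => /negP hN.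
  by apply: h; exists N.
have [h|Nn] := leqP n N; last first.
  by move/eqP: bN; case; exact: residue_eq_le (ltnW Nn) hb.
have [k /andP[nk _] /andP[/eqP k0 k1]] := sphere_ex h hb bN.
exists (k - n)%N => //; rewrite subnKC//; split; first exact/cylE.
by move=> /cylE /eqP; apply/negP.
Qed.

Lemma trivIset_sph n : trivIset setT (fun k => sph (n + k)).
Proof.
move=> i j _ _ [x [[i0 i1] [j0 j1]]].
have [ij|ij|//] := ltngtP i j.
  by exfalso; apply: i1; apply: cyl_sub j0; lia.
by exfalso; apply: j1; apply: cyl_sub i0; lia.
Qed.

End haar.

Lemma integrable_cstr d (T : measurableType d) (R : realType)
    (nu : {measure set T -> \bar R}) (E : set T) (f : T -> R) (r : R) :
  measurable E -> (nu E < +oo)%E -> (forall x, E x -> f x = r) ->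
  nu.-integrable E (EFin \o f) /\ \int[nu]_(x in E) f x = r * fine (nu E).
Proof.
move=> mE fE fr; split; last first.
  by rewrite -Rintegral_cst//; apply: eq_Rintegral => x; rewrite inE => /fr.
apply: (@eq_integrable _ _ _ _ E mE (EFin \o cst r)).
  by move=> x; rewrite inE /= => /fr ->.
apply/integrableP; split; first by apply/measurable_EFinP; exact: measurable_cst.
rewrite (eq_integral (cst `|r|%:E))//.
by rewrite integral_cst// lte_mul_pinfty// ?lee_fin.
Qed.

Section compactness.
Variables (p : nat) (p_pr : prime p) (X : Type).
Local Notation Zp := (padic_int p_pr).

(* Z_p is compact: a function without uniform level is bad on a nested sequence
   of balls, whose common point contradicts local constancy. *)
Lemma level_of_locally_constant (f : Zp -> X) :
  (forall a, exists n, forall b, residue b n = residue a n -> f b = f a) ->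
  exists n, level n f.
Proof.
move=> loc.
pose good n (a : Zp) k := (n <= k)%N /\ forall b c : Zp, residue b n = residue a n ->
  residue b k = residue c k -> f b = f c.
have split_good n (a : Zp) : (forall a', residue a' n = residue a n -> exists k, good n.+1 a' k) ->
    exists k, good n a k.
  move=> h.
  have h' (c : 'I_(p ^ n.+1)) : exists k, residue (c%:R : Zp) n = residue a n -> good n.+1 c%:R k.
    have [e|e] := eqVneq (residue (c%:R : Zp) n) (residue a n).
      by have [k hk] := h _ e; exists k.
    by exists 0%N => e'; move/eqP: e.
  have [k hk] := choice h'.
  exists (maxn n.+1 (\max_c k c)); split; first by rewrite leq_max leqnSn.
  move=> b c ba bc.
  have bcell := residue_cell n.+1 b.
  have e : residue ((cell n.+1 b)%:R : Zp) n = residue a n.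
    by rewrite (residue_eq_le (leqnSn n) bcell).
  have [_ hg] := hk _ e; apply: hg; first by rewrite bcell.
  apply: residue_eq_le bc; rewrite leq_max; apply/orP; right.
  exact: (leq_bigmax (cell n.+1 b)).
apply: contrapT => nolevel.
have bad0 : forall k, ~ good 0%N (0 : Zp) k.
  move=> k [_ h]; apply: nolevel; exists k => b c; apply: h.
  by rewrite -(residue_mod b) -(residue_mod 0) expn0 !modz1.
have step (na : nat * Zp) : exists a', (forall k, ~ good na.1 na.2 k) ->
    residue a' na.1 = residue na.2 na.1 /\ forall k, ~ good na.1.+1 a' k.
  case: na => n a /=.
  have [[k hk]|ng] := pselect (exists k, good n a k).
    by exists a => h; case: (h k).
  have : ~ forall a', residue a' n = residue a n -> exists k, good n.+1 a' k.
    by move=> h; apply: ng; exact: split_good.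
  move=> /existsNP[a' /not_implyP[ha' hb]]; exists a' => _; split => // k hk.
  by apply: hb; exists k.
have [g Hg] := choice step.
pose s := fix s n := if n is n'.+1 then g (n', s n') else (0 : Zp).
have s_bad n : forall k, ~ good n (s n) k.
  by elim: n => [//|n IH] /=; have [] := Hg (n, s n) IH.
have sS n : residue (s n.+1) n = residue (s n) n.
  by have [] := Hg (n, s n) (s_bad n).
have scoh n : (residue (s n.+1) n.+1 = residue (s n) n %[mod (p ^ n)%N])%Z.
  by rewrite residueS sS.
(* The centres [s n] define one point of Z_p. Where f is constant on its class modulo p^n, that
   class is good with k = n, a contradiction. *)
have [n hn] := loc (mk_pint p_pr scoh).
have xn : residue (mk_pint p_pr scoh) n = residue (s n) n.
  by rewrite /= residue_mod.
apply: (s_bad n n); split => // b c bs bc; rewrite xn in hn.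
by rewrite (hn b bs) (hn c)// -bc.
Qed.

End compactness.

(** * Integrals over F of functions with a singularity at y *)

Section integrals.
Variables (p : nat) (p_pr : prime p) (R : realType).
Local Notation Zp := (padic_int p_pr).
Local Notation Qp := (padic p_pr).
Local Notation ofint := (@padic_of_int p p_pr).
Local Notation nrm := (@nrm p p_pr R).
Local Notation zp_mean := (@zp_mean p p_pr R).
Local Notation ball := (@ball p p_pr R).
Implicit Types a b : Zp.
Variables (dx : {measure set Qp -> \bar R}) (dx_haar : is_haar dx) (m : nat).
Variables (y : Zp).
Hypothesis (ym : residue y m != 0).
Local Notation dom := (@dom p p_pr m).
Local Notation F a := ((dom a)%:R : R).
Local Notation sph := (sph y).
Local Notation mu := (mult_measure dx).

Let p1 : 1 < p%:R :> R. Proof. by rewrite ltr1n prime_gt1. Qed.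
Let p0 : 0 < p%:R :> R. Proof. by rewrite ltr0n prime_gt0. Qed.
Let px0 n : 0 < p%:R ^- n :> R. Proof. by rewrite invr_gt0 exprn_gt0. Qed.

Lemma cvg_geom (z : R) : 0 <= z -> z < 1 -> (fun n => z ^+ n) @ \oo --> 0.
Proof. by move=> z0 z1; apply: cvg_expr; rewrite ger0_norm. Qed.

Lemma mult_measure_cyl n a : (m <= n)%N -> dom a ->
  mu (cyl n a) = ((nrm a)^-1 * p%:R ^- n)%:E.
Proof.
move=> mn da; rewrite (@mult_measure_cst _ _ _ _ _ (nrm a)).
- by rewrite (haar_cyl dx_haar) EFinM.
- exact: measurable_cyl.
- move=> _ [b ba <-]; apply/esym/nrm_cong; last exact: da.
  exact/esym/(residue_eq_le mn).
Qed.

Lemma mult_measure_sph n : (m <= n)%N ->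
  mu (sph n) = ((nrm y)^-1 * (p%:R ^- n - p%:R ^- n.+1))%:E.
Proof.
move=> mn; rewrite (@mult_measure_cst _ _ _ _ _ (nrm y)).
- by rewrite (haar_sph dx_haar) EFinM.
- exact: measurable_sph.
- move=> _ [[b ba <-] _]; apply/esym/nrm_cong; last exact: ym.
  exact/esym/(residue_eq_le mn).
Qed.

Lemma mult_measure_set1 : mu [set ofint y] = 0%E.
Proof.
rewrite (@mult_measure_cst _ _ _ _ _ (nrm y)).
- by rewrite (haar_set1 dx_haar) mule0.
- exact: measurable_padic_set1.
- by move=> _ ->.
Qed.

(** The recursion telescopes the integrals over spheres, and [A] tending to 0 removes the remainder.
    As g <= C, the function C - f is nonnegative off y, so countable additivity applies to it
    without prior integrability. *)
Lemma Rintegral_spheres n (f : Qp -> R) (g A : nat -> R) (C : R) : (m <= n)%N ->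
  (forall k x, (n <= k)%N -> sph k x -> f x = g k) ->
  (forall k, (n <= k)%N -> g k <= C) ->
  (forall k, (n <= k)%N -> A k = (p%:R ^- k - p%:R ^- k.+1) * g k + A k.+1) ->
  A @ \oo --> 0 ->
  mu.-integrable (cyl n y) (EFin \o f) /\
  \int[mu]_(x in cyl n y) f x = A n / nrm y.
Proof.
move=> mn fg gC AE A0; set w := (nrm y)^-1.
have w0 : 0 <= w by rewrite invr_ge0 nrm_ge0.
pose D := \bigcup_k sph (n + k).
have mS k : measurable (sph (n + k)) by exact: measurable_sph.
have mD : measurable D by exact: bigcup_measurable.
have mf : measurable_fun D (EFin \o f).
  rewrite measurable_fun_bigcup// => k.
  apply: (@eq_measurable_fun _ _ _ _ _ (cst (g (n + k)%N)%:E)); last exact: measurable_cst.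
  by move=> x; rewrite inE => /(fg _ _ (leq_addr _ _)) /= ->.
have mh : measurable_fun D (EFin \o (fun x => C - f x)).
  by apply/measurable_EFinP; apply: measurable_funB => //; exact/measurable_EFinP.
have hI : (\int[mu]_(x in D) (C - f x)%:E = (w * (C * p%:R ^- n - A n))%:E)%E.
  rewrite ge0_integral_bigcup//; last 2 first.
  - move=> x [k _ /(fg _ _ (leq_addr _ _)) ->].
    by rewrite lee_fin subr_ge0 gC// leq_addr.
  - exact: trivIset_sph.
  have pieces k : (\int[mu]_(x in sph (n + k)) (C - f x)%:E =
     (w * ((C - g (n + k)%N) * (p%:R ^- (n + k) - p%:R ^- (n + k).+1)))%:E)%E.
    rewrite (eq_integral (cst (C - g (n + k)%N)%:E)); last first.
      by move=> x; rewrite inE => /(fg _ _ (leq_addr _ _)) ->.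
    rewrite integral_cst//= mult_measure_sph ?(leq_trans mn) ?leq_addr//.
    by rewrite -EFinM -/w; congr (_%:E); ring.
  apply/cvg_lim => //.
  have -> : (fun K => \sum_(0 <= k < K) \int[mu]_(x in sph (n + k)) (C - f x)%:E)%E =
      (fun K => (w * (C * (p%:R ^- n - p%:R ^- (n + K)) - (A n - A (n + K)%N)))%:E).
    apply/funext; elim => [|K IH].
      by rewrite big_geq// addn0 !subrr mulr0 subrr mulr0.
    rewrite big_nat_recr//= IH pieces -EFinD; congr (_%:E).
    by rewrite addnS [in A n - A (n + K)%N](AE (n + K)%N) ?leq_addr//; ring.
  apply: cvg_EFin; first by near=> K.
  apply: cvgM; first exact: cvg_cst.
  apply: cvgB.
    rewrite -[X in _ --> C * X]subr0; apply: cvgM; first exact: cvg_cst.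
    apply: cvgB; first exact: cvg_cst.
    have -> : (fun K => p%:R ^- (n + K) : R) = (fun K => p%:R ^- n * (p%:R^-1) ^+ K).
      by apply/funext => K; rewrite exprD invfM exprVn.
    rewrite -(mulr0 (p%:R ^- n)); apply: cvgM; first exact: cvg_cst.
    by apply: cvg_geom; rewrite ?invr_ge0 ?ltW// invf_lt1.
  rewrite -[X in _ --> X]subr0; apply: cvgB; first exact: cvg_cst.
  have -> : (fun K => A (n + K)%N) = [sequence A (K + n)%N]_K.
    by apply/funext => K; rewrite addnC.
  by rewrite cvg_shiftn.
have hfin : mu.-integrable D (EFin \o (fun x => C - f x)).
  apply/integrableP; split => //.
  rewrite (eq_integral (EFin \o (fun x => C - f x))); last first.
    move=> x; rewrite inE => -[k _ /(fg _ _ (leq_addr _ _)) fx].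
    by rewrite /= ger0_norm// fx subr_ge0 gC// leq_addr.
  by rewrite hI ltry.
have [cD cI] : mu.-integrable D (EFin \o cst C) /\
    \int[mu]_(x in D) C = C * (w * p%:R ^- n).
  have e : mu D = (w * p%:R ^- n)%:E.
    rewrite -(mult_measure_cyl mn (a := y))// cyl_sph measureU//.
    - by transitivity (mu [set ofint y] + mu D)%E => //; rewrite mult_measure_set1 add0e.
    - exact: measurable_padic_set1.
    - apply/seteqP; split=> // x [-> [k _ [_]]]; apply; exact/cylE.
  have muD : (mu D < +oo)%E by rewrite e ltry.
  have [//|h1 h2] := @integrable_cstr _ _ R mu D (cst C) C mD muD.
  split => //; apply: (etrans h2); congr (_ * _).
  by transitivity (fine (mu D)) => //; rewrite e.
have fD : mu.-integrable D (EFin \o f) /\ \int[mu]_(x in D) f x = w * A n.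
  have fE : f = (fun x => C - (C - f x)) by apply/funext => x; ring.
  split.
    have := integrableB mD cD hfin; apply: eq_integrable => // x _ /=.
    by rewrite -EFinB; congr (_%:E); ring.
  rewrite [in LHS]fE RintegralB// cI.
  by rewrite [X in _ - X]/Rintegral hI /=; ring.
(* [f (ofint y)] is arbitrary, so the point is split off as a null set. *)
pose E i := if i is 0%N then [set ofint y] else D.
have mE i : measurable (E i) by case: i => [|i] //=; exact: measurable_padic_set1.
have tE : trivIset [set` [:: 0%N; 1%N]] E.
  have yS k : ~ sph (n + k) (ofint y) by case=> _; apply; exact/cylE.
  move=> [|[|i]] [|[|j]] //= _ _ [x [/= h h']].
  - by move: h' h => /[swap] -> [k _ /yS].
  - by move: h h' => /[swap] -> [k _ /yS].
have iE i : i \in [:: 0%N; 1%N] -> mu.-integrable (E i) (EFin \o f).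
  rewrite !inE => /orP[] /eqP -> /=; last by have [] := fD.
  apply: null_set_integrable; [exact: measurable_padic_set1| |exact: mult_measure_set1].
  exact: measurable_fun_set1.
have uE : uniq [:: 0%N; 1%N] by [].
have DE : \big[setU/set0]_(i <- [:: 0%N; 1%N]) E i = cyl n y.
  by rewrite !big_cons big_nil /= setU0 -cyl_sph.
have [] := Rintegral_bigsetU uE tE mE iE.
rewrite DE !big_cons big_nil addr0 /= => fi fI; split => //; rewrite fI.
have [_ ->] := fD.
rewrite /Rintegral null_set_integral; [by rewrite add0r mulrC|exact: measurable_padic_set1| |exact: mult_measure_set1].
exact: measurable_fun_set1.
Unshelve. all: end_near. Qed.

Lemma fund_domain_cyl n : (m <= n)%N ->
  fund_domain p p_pr m =
  \big[setU/set0]_(c <- [seq c : 'I_(p ^ n) <- enum 'I_(p ^ n) | dom c%:R]) cyl n c%:R.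
Proof.
move=> mn; rewrite big_filter bigsetU_cyl fund_domainE; congr (ofint @` _).
apply/funext => a /=; rewrite /dom.
by rewrite (residue_eq_le mn (residue_cell n a)).
Qed.

Lemma Rintegral_fund_domain (nu : {measure set Qp -> \bar R}) n (f : Qp -> R) :
  (m <= n)%N ->
  (forall c : 'I_(p ^ n), dom c%:R -> nu.-integrable (cyl n c%:R) (EFin \o f)) ->
  nu.-integrable (fund_domain p p_pr m) (EFin \o f) /\
  \int[nu]_(x in fund_domain p p_pr m) f x =
    \sum_(c < p ^ n) F c%:R * \int[nu]_(x in cyl n c%:R) f x.
Proof.
move=> mn fi; rewrite (fund_domain_cyl mn).
have [||||h1 h2] := @Rintegral_bigsetU _ _ R nu _ [seq c : 'I_(p ^ n) <- enum 'I_(p ^ n) | dom c%:R]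
    (fun c : 'I_(p ^ n) => cyl n c%:R) f.
- by rewrite filter_uniq// enum_uniq.
- exact: trivIset_cyl.
- by move=> c; exact: measurable_cyl.
- by move=> c; rewrite mem_filter => /andP[dc _]; exact: fi.
split => //; rewrite h2 big_filter big_mkcond big_enum/=.
by apply: eq_bigr => c _; case: (dom _); rewrite ?mul1r ?mul0r.
Qed.

Lemma Rintegral_haar n (f : Qp -> R) : (m <= n)%N ->
  (forall a b, dom a -> residue a n = residue b n -> f (ofint b) = f (ofint a)) ->
  \int[dx]_(x in fund_domain p p_pr m) f x = zp_mean n (fun a => F a * f (ofint a)).
Proof.
move=> mn fl.
have piece (c : 'I_(p ^ n)) : dom c%:R -> dx.-integrable (cyl n c%:R) (EFin \o f) /\
    \int[dx]_(x in cyl n c%:R) f x = f (ofint c%:R) * p%:R ^- n.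
  move=> dc; rewrite -[p%:R ^- n]/(fine (p%:R ^- n)%:E) -(haar_cyl dx_haar n c%:R).
  apply: integrable_cstr; first exact: measurable_cyl.
    by rewrite (haar_cyl dx_haar) ltry.
  by move=> _ [b /esym hb <-]; exact: fl.
have [|_ ->] := @Rintegral_fund_domain dx n f mn; first by move=> c /piece[].
rewrite /zp_mean mulr_sumr; apply: eq_bigr => c _.
by have [/piece[_ ->]|_] := boolP (dom _); rewrite ?mul0r ?mulr0// !mul1r mulrC.
Qed.

(** The singular factor g is controlled near y only through its integral; the factor h is constant
    on that ball and comes out of it. Elsewhere the integral is a finite sum. *)
Lemma Rintegral_mult_measure n (g h : Qp -> R) (G : R) : (m <= n)%N ->
  (forall a b, dom a -> residue a n != residue y n -> residue a n = residue b n ->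
    g (ofint b) = g (ofint a)) ->
  (forall a b, dom a -> residue a n = residue b n -> h (ofint b) = h (ofint a)) ->
  mu.-integrable (cyl n y) (EFin \o g) ->
  \int[mu]_(x in cyl n y) g x = G / nrm y ->
  mu.-integrable (fund_domain p p_pr m) (EFin \o (fun x => g x * h x)) /\
  \int[mu]_(x in fund_domain p p_pr m) (g x * h x) =
    zp_mean n (fun a => F a * ((1 - ball n y a) * (g (ofint a) * h (ofint a) / nrm a)))
    + h (ofint y) * (G / nrm y).
Proof.
move=> mn gl hl gi gG.
have dy : dom y by exact: ym.
have piece (c : 'I_(p ^ n)) : dom c%:R ->
    mu.-integrable (cyl n c%:R) (EFin \o (fun x => g x * h x)) /\
    \int[mu]_(x in cyl n c%:R) (g x * h x) =
    p%:R ^- n * ((1 - ball n y c%:R) * (g (ofint c%:R) * h (ofint c%:R) / nrm c%:R))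
     + (c == cell n y)%:R * (h (ofint y) * (G / nrm y)).
  move=> dc; have [yc|yc] := eqVneq (residue y n) (residue (c%:R : Zp) n).
    have -> : c == cell n y by rewrite -(cell_nat p_pr c) (cell_eq yc).
    rewrite /ball yc eqxx subrr mul0r mulr0 add0r mul1r.
    have -> : cyl n c%:R = cyl n y :> set Qp by rewrite /cyl yc.
    have mC : measurable (cyl n y) by exact: measurable_cyl.
    have ghE : {in cyl n y, (EFin \o (fun x => h (ofint y) * g x)) =1 EFin \o (fun x => g x * h x)}.
      move=> x; rewrite inE => -[b /esym hb <-] /=.
      by rewrite (hl y b)// mulrC.
    have hgi : mu.-integrable (cyl n y) (EFin \o (fun x => h (ofint y) * g x)).
      exact: (integrableZl mC (h (ofint y)) gi).
    split; first exact: eq_integrable ghE hgi.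
    rewrite -gG -RintegralZl//; apply: eq_Rintegral => x /ghE /= [].
    by move=> <-.
  have -> : (c == cell n y) = false.
    by apply: contraNF yc => /eqP ->; rewrite residue_cell.
  rewrite /ball (negbTE yc) subr0 mul1r mul0r addr0.
  have muF : (mu (cyl n c%:R) < +oo)%E by rewrite mult_measure_cyl// ltry.
  have [|||h1 h2] := @integrable_cstr _ _ R mu (cyl n c%:R) (fun x => g x * h x) (g (ofint c%:R) * h (ofint c%:R)).
  - exact: measurable_cyl.
  - exact: muF.
  - move=> _ [b /esym hb <-]; rewrite (hl _ _ dc hb) (gl _ _ dc _ hb)//.
    by rewrite eq_sym.
  split => //; rewrite h2.
  transitivity (g (ofint c%:R) * h (ofint c%:R) * fine (mu (cyl n c%:R))) => //.
  by rewrite mult_measure_cyl//=; ring.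
have [|h1 ->] := @Rintegral_fund_domain mu n (fun x => g x * h x) mn; first by move=> c /piece[].
split => //; rewrite /zp_mean mulr_sumr.
rewrite [X in _ + X](_ : _ = \sum_(c < p ^ n) (c == cell n y)%:R * (h (ofint y) * (G / nrm y))); last first.
  by rewrite (bigD1 (cell n y))//= eqxx mul1r big1 ?addr0// => c /negbTE ->; rewrite mul0r.
rewrite -big_split/=; apply: eq_bigr => c _.
have [dc|dc] := boolP (dom c%:R).
  by have [_ ->] := piece _ dc; rewrite !mul1r.
have -> : (c == cell n y) = false.
  apply: contraNF dc => /eqP ->; rewrite /dom.
  by rewrite (residue_eq_le mn (residue_cell n y)).
by rewrite !mul0r mulr0 addr0.
Qed.

End integrals.

(** * The solution *)

Section solution.
Variables (p : nat) (p_pr : prime p) (R : realType).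
Local Notation Zp := (padic_int p_pr).
Local Notation Qp := (padic p_pr).
Local Notation ofint := (@padic_of_int p p_pr).
Local Notation nrm := (@nrm p p_pr R).
Local Notation zp_mean := (@zp_mean p p_pr R).
Local Notation ball := (@ball p p_pr R).
Implicit Types a b : Zp.
Variables (dx : {measure set Qp -> \bar R}) (dx_haar : is_haar dx) (m : nat).
Variables (y : Zp) (rho : R).
Hypotheses (ym : residue y m != 0) (rho0 : 0 < rho).
Local Notation dom := (@dom p p_pr m).
Local Notation F a := ((dom a)%:R : R).
Local Notation mu := (mult_measure dx).
Variables (u : Zp -> R) (A M : nat -> R).
Hypothesis profile : mean_field_profile m y rho u A M.

Let p1 : 1 < p%:R :> R. Proof. by rewrite ltr1n prime_gt1. Qed.
Let p0 : 0 < p%:R :> R. Proof. by rewrite ltr0n prime_gt0. Qed.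
Let px0 n : 0 < p%:R ^- n :> R. Proof. by rewrite invr_gt0 exprn_gt0. Qed.
Let y0 : 0 < nrm y.
Proof. by rewrite nrm_gt0//; apply: contraNneq ym => ->; rewrite /= mod0z. Qed.

(** Carries functions on Z_p to Q_p; the default 0 is only taken off Z_p, hence off F. *)
Definition int_part (x : Qp) : Zp := xget 0 [set a | ofint a = x].

Lemma int_partK : cancel ofint int_part.
Proof.
by move=> a; apply: padic_of_int_inj; exact: (@xgetPex _ 0 [set b | ofint b = ofint a]) (ex_intro _ a erefl).
Qed.

Let uQ (x : Qp) : R := u (int_part x).
Let s n := y + (p ^ n)%:R : Zp.

(** The mean p^n A n is at most C and loses at most (p - 1) C per step, a loss that the factor p^-n
    beats. In place of the linear lower bound a geometric one of ratio 3/2 is used, since 3/2 < 2 <=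
    p. *)
Lemma profile_cvg0 : (A @ \oo --> 0) /\ (M @ \oo --> 0).
Proof.
have [_ _ _ rec [C bd]] := profile.
have geom (z : R) (c : R) : 0 <= z -> z < 1 -> (fun n => c * z ^+ n) @ \oo --> 0.
  move=> z0 z1; rewrite -(mulr0 c); apply: cvgM; first exact: cvg_cst.
  exact: cvg_geom.
have pV0 : 0 <= p%:R^-1 :> R by rewrite invr_ge0 ltW.
have pV1 : p%:R^-1 < 1 :> R by rewrite invf_lt1.
split; last first.
  apply: (@squeeze_cvgr _ _ _ _ (cst 0) (fun n => C * (p%:R^-1) ^+ n)).
  - near=> n; have [|_ + _] := bd n; first by near: n; exact: nbhs_infty_ge.
    by rewrite /= [C * _]mulrC exprVn.
  - exact: cvg_cst.
  - exact: geom.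
pose alpha k := p%:R ^+ k * A k.
have step k : (m <= k)%N -> alpha k - (p%:R - 1) * C <= alpha k.+1.
  move=> mk; have [/andP[_ h] _ _] := bd _ mk; have [Ak _] := rec _ mk.
  have pS : p%:R ^- k.+1 = p%:R ^- k / p%:R :> R by rewrite exprSr invfM mulrC.
  have e : alpha k.+1 = alpha k - (p%:R - 1) * (u (s k) - alpha k).
    rewrite /alpha [X in p%:R ^+ k * X]Ak -/(s k) pS exprSr; field.
    by rewrite !gt_eqF ?exprn_gt0.
  rewrite e lerD2l lerN2 ler_pM2l// subr_gt0//.
(* The factor 2 makes one loss at most D/2, hence at most the growth of D (3/2)^k in one step. *)
pose D := Num.max (2 * ((p%:R - 1) * C)) `|alpha m|.
have D0 : 0 <= D by rewrite le_max normr_ge0 orbT.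
have D1 : 2 * ((p%:R - 1) * C) <= D by rewrite le_max lexx.
have D2 : `|alpha m| <= D by rewrite le_max lexx orbT.
have low k : - (D * (3 / 2) ^+ k) <= alpha (m + k)%N.
  elim: k => [|k IH].
    by rewrite expr0 mulr1 addn0 lerNl (le_trans _ D2)// -normrN ler_norm.
  rewrite addnS; apply: le_trans (step _ (leq_addr _ _)).
  have h1 : 1 <= (3 / 2 : R) ^+ k by rewrite exprn_ege1//; lra.
  have h2 : D <= D * (3 / 2) ^+ k by rewrite ler_peMr.
  by rewrite exprSr; lra.
rewrite -(cvg_shiftn m).
have AE k : A (k + m)%N = alpha (m + k)%N * p%:R ^- m * (p%:R^-1) ^+ k.
  rewrite /alpha [(k + m)%N]addnC exprD exprVn; field.
  by rewrite !gt_eqF ?exprn_gt0.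
apply: (@squeeze_cvgr _ _ _ _ (fun k => (- D * p%:R ^- m) * (3 / 2 / p%:R) ^+ k)
  (fun k => (C * p%:R ^- m) * (p%:R^-1) ^+ k)).
- near=> k; rewrite /= AE; apply/andP; split.
    rewrite expr_div_n -[p%:R ^- k]exprVn.
    have -> : - D * p%:R ^- m * ((3 / 2) ^+ k * (p%:R^-1) ^+ k) =
              - (D * (3 / 2) ^+ k) * p%:R ^- m * (p%:R^-1) ^+ k by ring.
    by rewrite ler_pM2r ?exprn_gt0 ?invr_gt0// ler_pM2r.
  have [|_ _ h] := bd (m + k)%N; first by rewrite leq_addr.
  by rewrite ler_pM2r ?exprn_gt0 ?invr_gt0// ler_pM2r.
- apply: geom; first by rewrite divr_ge0 ?ltW//; lra.
  rewrite ltr_pdivrMr// mul1r; apply: (@lt_le_trans _ _ 2); first lra.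
  by rewrite (ler_nat _ 2) prime_gt1.
- exact: geom.
Unshelve. all: end_near. Qed.

(** Extending phi by [x0] to the rest of Z_p keeps it locally constant, F being a union of classes
    modulo p^m; compactness of Z_p then gives a uniform level. *)
Lemma locally_constant_level (X : Type) (x0 : X) (phi : Qp -> X) :
  locally_constant_on (fund_domain p p_pr m) phi ->
  exists2 n, (m <= n)%N &
    forall a b, dom a -> residue a n = residue b n -> phi (ofint b) = phi (ofint a).
Proof.
move=> lc; pose f a := if dom a then phi (ofint a) else x0.
have [a|n hn] := @level_of_locally_constant p p_pr X f.
  have [da|nda] := boolP (dom a); last first.
    exists m => b ba; have ndb : ~~ dom b by rewrite /dom ba.
    by rewrite /f (negbTE ndb) (negbTE nda).
  have Fa : fund_domain p p_pr m (ofint a) by rewrite fund_domainE; exists a.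
  have : nbhs (ofint a) [set z | fund_domain p p_pr m z -> phi z = phi (ofint a)].
    exact: lc Fa.
  rewrite nbhsE => -[V [oV Va] VS].
  have [e e0 eV] := oV _ Va.
  have [n ne] : exists n, (p%:R ^- n : rat) < e.
    have pq : 0 < p%:R :> rat by rewrite ltr0n prime_gt0.
    exists (Num.bound e^-1); rewrite invf_plt ?posrE ?exprn_gt0//.
    apply: (lt_trans (archi_boundP _)); first by rewrite invr_ge0 ltW.
    by rewrite -natrX ltr_nat ltn_expl// prime_gt1.
  exists (maxn m n) => b ba.
  have db : dom b by rewrite /dom (residue_eq_le (leq_maxl m n) ba).
  rewrite /f da db; apply: VS; last by rewrite fund_domainE; exists b.
  apply: eV => /=; rewrite -padic_of_intB; apply: le_lt_trans ne.
  have := @nrm_close p p_pr rat b a n; rewrite /nrm => ->.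
  by rewrite (residue_eq_le (leq_maxr m n) ba).
exists (maxn m n); first exact: leq_maxl.
move=> a b da ab; have := hn _ _ (residue_eq_le (leq_maxr m n) ab).
by rewrite /f /dom -(residue_eq_le (leq_maxl m n) ab) -/(dom a) da.
Qed.

Lemma u_far n a b : (m <= n)%N -> dom a -> residue a n != residue y n ->
  residue a n = residue b n -> u b = u a.
Proof.
move=> mn da ay ab; have [inv _ _ _ _] := profile; apply/esym/inv => //.
- by apply: contraNneq ay => ->.
- exact: nrm_cong (residue_eq_le mn ab) da.
- exact: nrm_cong_sub ab ay.
Qed.

Lemma uQ_locally_constant : locally_constant_on (fund_domain p p_pr m `\ ofint y) uQ.
Proof.
move=> x [Fx ay]; have [a da ea] : (ofint @` [set a | residue a m != 0]) x.
  by rewrite -fund_domainE.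
rewrite -{}ea in ay *.
have : a != y by apply/eqP => e; apply: ay; rewrite e.
rewrite -subr_eq0 => /residue_neq0[k]; rewrite residue_subr_eq0 => ak.
have an : residue a (maxn m k.+1) != residue y (maxn m k.+1).
  by apply: contra ak => /eqP/(residue_eq_le (leq_maxr m k.+1)) ->.
suff h : nbhs (ofint a) [set z | (fund_domain p p_pr m `\ ofint y) z -> uQ z = uQ (ofint a)].
  exact: h.
rewrite nbhsE; exists (cyl (maxn m k.+1) a).
  by split; [exact: padic_open_cyl|exact/cylE].
move=> _ [b ba <-] _; rewrite /uQ !int_partK.
by apply: (u_far _ da an); rewrite ?leq_maxl.
Qed.

Lemma uQ_sphere k x : (m <= k)%N -> sph y k x -> uQ x = u (s k).
Proof.
move=> mk [[b bk <-] nb]; rewrite /uQ int_partK.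
have Sb : sphere y k b.
  by rewrite /sphere bk eqxx; apply: contra_notN nb => /eqP h; exact/cylE.
have S := sphere_shift y k; have /andP[/eqP sk _] := S.
have [db eb] := near_y R ym mk bk; have [_ es] := near_y R ym mk sk.
have [inv _ _ _ _] := profile; apply: inv => //.
- by apply: contra_notN nb => /eqP ->; exact/cylE.
- by rewrite eb es.
- by rewrite (nrm_sphere R Sb) (nrm_sphere R S).
Qed.

Lemma uQ_cyl n : (m <= n)%N ->
  (mu.-integrable (cyl n y) (EFin \o uQ) /\
   \int[mu]_(x in cyl n y) uQ x = A n / nrm y) /\
  (mu.-integrable (cyl n y) (EFin \o (expR \o uQ)) /\
   \int[mu]_(x in cyl n y) (expR \o uQ) x = M n / nrm y).
Proof.
move=> mn; have [A0 M0] := profile_cvg0; have [_ _ _ rec [C bd]] := profile.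
have sC k : (n <= k)%N -> u (s k) <= C + C.
  by move=> nk; have [/andP[_ h1] _ h2] := bd k (leq_trans mn nk); rewrite /s; lra.
split.
  apply: (@Rintegral_spheres _ _ _ _ dx_haar _ _ ym n uQ (fun k => u (s k)) A (C + C)) => //.
    by move=> k x nk; apply: uQ_sphere; exact: leq_trans nk.
  by move=> k nk; have [] := rec k (leq_trans mn nk).
apply: (@Rintegral_spheres _ _ _ _ dx_haar _ _ ym n (expR \o uQ) (fun k => expR (u (s k))) M (expR (C + C))) => //.
- by move=> k x nk /(uQ_sphere (leq_trans mn nk)) /= ->.
- by move=> k nk; rewrite ler_expR sC.
- by move=> k nk; have [] := rec k (leq_trans mn nk).
Qed.

Lemma uQ_integral n (h : Qp -> R) : (m <= n)%N ->
  (forall a b, dom a -> residue a n = residue b n -> h (ofint b) = h (ofint a)) ->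
  (mu.-integrable (fund_domain p p_pr m) (EFin \o (fun x => uQ x * h x)) /\
   \int[mu]_(x in fund_domain p p_pr m) (uQ x * h x) =
    zp_mean n (fun a => F a * ((1 - ball n y a) * (u a * h (ofint a) / nrm a)))
    + h (ofint y) * (A n / nrm y)) /\
  (mu.-integrable (fund_domain p p_pr m) (EFin \o (fun x => expR (uQ x) * h x)) /\
   \int[mu]_(x in fund_domain p p_pr m) (expR (uQ x) * h x) =
    zp_mean n (fun a => F a * ((1 - ball n y a) * (expR (u a) * h (ofint a) / nrm a)))
    + h (ofint y) * (M n / nrm y)).
Proof.
move=> mn hl; have [[i1 e1] [i2 e2]] := uQ_cyl mn.
have far a b : dom a -> residue a n != residue y n -> residue a n = residue b n ->
    uQ (ofint b) = uQ (ofint a).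
  by move=> da ay ab; rewrite /uQ !int_partK; exact: u_far ab.
have [j1 f1] := Rintegral_mult_measure dx_haar ym mn far hl i1 e1.
have far' a b : dom a -> residue a n != residue y n -> residue a n = residue b n ->
    (expR \o uQ) (ofint b) = (expR \o uQ) (ofint a).
  by move=> da ay ab /=; rewrite (far a b).
have [j2 f2] := Rintegral_mult_measure dx_haar ym mn far' hl i2 e2.
split; split => //.
  by rewrite f1; congr (_ + _); apply: eq_zp_mean => a; rewrite /uQ int_partK.
by rewrite f2; congr (_ + _); apply: eq_zp_mean => a; rewrite /uQ /= int_partK.
Qed.

(** Self-adjointness of the operator of a symmetric kernel, stated for finite sums so that the
    diagonal raises no convergence question. *)
Lemma zp_mean_green n (K : Zp -> Zp -> R) (f g : Zp -> R) :
  (forall a b, K a b = K b a) ->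
  zp_mean n (fun a => f a * zp_mean n (fun b => K a b * (g b - g a))) =
  zp_mean n (fun a => g a * zp_mean n (fun b => K a b * (f b - f a))).
Proof.
move=> Ksym.
have E (v w : Zp -> R) : zp_mean n (fun a => v a * zp_mean n (fun b => K a b * (w b - w a))) =
    zp_mean n (fun a => zp_mean n (fun b => K a b * v a * w b))
    - zp_mean n (fun a => zp_mean n (fun b => K a b * v a * w a)).
  rewrite -zp_meanB; apply: eq_zp_mean => a; rewrite -zp_meanB -zp_meanZ.
  by apply: eq_zp_mean => b; ring.
rewrite !E; congr (_ - _).
  rewrite exchange_zp_mean; apply: eq_zp_mean => a; apply: eq_zp_mean => b.
  by rewrite Ksym; ring.
by apply: eq_zp_mean => a; apply: eq_zp_mean => b; ring.
Qed.

Let kernel a b := F a * F b / nrm (a - b) ^+ 2.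

Lemma kernel_sym a b : kernel a b = kernel b a.
Proof. by rewrite /kernel nrmBC [F a * _]mulrC. Qed.

(** * The equation tested against a function of level n *)

Section weak_equation.
Variables (phi : Qp -> R) (n : nat).
Hypotheses (mn : (m <= n)%N)
  (phi_level : forall a b, dom a -> residue a n = residue b n ->
    phi (ofint b) = phi (ofint a)).

Lemma D_opE a : dom a -> D_op dx m phi (ofint a) =
  nrm a * zp_mean n (fun b => F b * ((phi (ofint b) - phi (ofint a)) / nrm (b - a) ^+ 2)).
Proof.
move=> da; rewrite /D_op -/(nrm a); congr (_ * _).
rewrite (Rintegral_haar dx_haar mn).
  by apply: eq_zp_mean => b; rewrite -padic_of_intB.
move=> b b' db bb'; rewrite -!padic_of_intB -!/(nrm _) (phi_level db bb').
have [ba|ba] := eqVneq (residue b n) (residue a n).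
  by rewrite (phi_level da (esym ba)) subrr !mul0r.
by rewrite (nrm_cong_sub bb' ba).
Qed.

(** The integrand vanishes on the class of a, where phi is constant; outside it the kernel depends
    on a only modulo p^n. *)
Lemma D_op_level a b : dom a -> residue a n = residue b n ->
  D_op dx m phi (ofint b) = D_op dx m phi (ofint a).
Proof.
move=> da ab; have abm := residue_eq_le mn ab.
have db : dom b by rewrite /dom -abm.
rewrite !D_opE// -(nrm_cong abm da); congr (_ * _); apply: eq_zp_mean => c.
have [dc|] := boolP (dom c); last by rewrite !mul0r.
rewrite (phi_level da ab); congr (_ * _).
have [ac|ac] := eqVneq (residue a n) (residue c n).
  by rewrite (phi_level da ac) subrr !mul0r.
by rewrite [nrm (c - b)]nrmBC [nrm (c - a)]nrmBC (nrm_cong_sub ab ac).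
Qed.

(** u with its values on the ball around y replaced by their mean. The operator applied to phi is
    constant on that ball, so its integral against u sees no difference. *)
Let v a := ball n y a * (p%:R ^+ n * A n) + (1 - ball n y a) * u a.

Lemma D_op_mean :
  \int[mu]_(x in fund_domain p p_pr m) (uQ x * D_op dx m phi x) =
  zp_mean n (fun a => v a * zp_mean n (fun b => kernel a b * (phi (ofint b) - phi (ofint a)))).
Proof.
have [[_ ->] _] := uQ_integral mn D_op_level.
pose S a := F a * (D_op dx m phi (ofint a) / nrm a).
have SE a : zp_mean n (fun b => kernel a b * (phi (ofint b) - phi (ofint a))) = S a.
  rewrite /S; have [da|nda] := boolP (dom a); last first.
    rewrite mul0r -(zp_mean_cst p_pr n 0); apply: eq_zp_mean => b.
    by rewrite /kernel (negbTE nda) !mul0r.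
  rewrite D_opE// [nrm a * _]mulrC mulfK ?mul1r; last first.
    by rewrite gt_eqF// nrm_gt0//; apply: contraTneq da => ->; rewrite /dom /= mod0z.
  by apply: eq_zp_mean => b; rewrite /kernel da nrmBC mul1r; ring.
have -> : D_op dx m phi (ofint y) * (A n / nrm y) =
    zp_mean n (fun a => ball n y a * (p%:R ^+ n * A n * S a)).
  rewrite (@zp_mean_ball_cst _ _ R n n y (fun a => p%:R ^+ n * A n * S a))//.
    by rewrite /S [dom y]ym mulr1n; field; rewrite !gt_eqF ?exprn_gt0.
  move=> b yb; congr (_ * _); rewrite /S (D_op_level _ yb)//.
  have [-> ->] := near_y R ym mn (esym yb); by rewrite [dom y]ym.
rewrite -zp_meanD; apply: eq_zp_mean => a; rewrite SE /S /v; ring.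
Qed.

Lemma kernel_potential a : dom a -> residue a n != residue y n ->
  zp_mean n (fun b => kernel a b * (v b - v a)) = - (rho * (expR (u a) / nrm a)).
Proof.
move=> da ay; have [_ eqn _ _ _] := profile; rewrite -(eqn n a mn da ay).
have va : v a = u a by rewrite /v /ball eq_sym (negbTE ay) mulr0n; ring.
have -> : (p%:R ^- n * u a - A n) / nrm (a - y) ^+ 2 =
    zp_mean n (fun b => ball n y b * ((u a - p%:R ^+ n * A n) / nrm (a - b) ^+ 2)).
  rewrite (@zp_mean_ball_cst _ _ R n n y (fun b => (u a - p%:R ^+ n * A n) / nrm (a - b) ^+ 2))//.
    rewrite mulrA mulrBr mulKf//; by rewrite gt_eqF// exprn_gt0.
  move=> b yb; congr (_ / _ ^+ 2); rewrite nrmBC [RHS]nrmBC.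
  by apply/esym/nrm_cong_sub; [exact: yb|rewrite eq_sym].
rewrite -zp_meanD -[RHS]mulN1r -zp_meanZ; apply: eq_zp_mean => b.
rewrite va /v /kernel da /ball; have [yb|yb] := eqVneq (residue y n) (residue b n).
  have [-> _] := near_y R ym mn (esym yb); rewrite !mulr1n; ring.
rewrite !mulr0n mulr1n; ring.
Qed.

(** Self-adjointness moves the operator onto [v]. The result [G] is known off the ball by
    [kernel_potential]; on the ball only its integral matters, since phi is constant there. That
    integral follows from the vanishing total of [G] and the mass identity: it is rho (1 - M n /
    |y|), whose first term produces the point mass at y and whose second cancels the part of e^u in
    the ball. *)
Lemma weak_mean_field :
  \int[mu]_(x in fund_domain p p_pr m) (uQ x * D_op dx m phi x)
  + rho * \int[mu]_(x in fund_domain p p_pr m) (expR (uQ x) * phi x) = rho * phi (ofint y).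
Proof.
have [_ [_ ->]] := uQ_integral mn phi_level.
rewrite D_op_mean (zp_mean_green _ _ (fun a => phi (ofint a)) kernel_sym).
pose G a := zp_mean n (fun b => kernel a b * (v b - v a)).
rewrite -/(G _).
pose H (f : Zp -> R) a := F a * ((1 - ball n y a) * (expR (u a) * f a / nrm a)).
have GE (f : Zp -> R) a : f a * G a = - rho * H f a + ball n y a * (f a * G a).
  rewrite /H; have [da|nda] := boolP (dom a); last first.
    have -> : G a = 0.
      rewrite -(zp_mean_cst p_pr n 0); apply: eq_zp_mean => b.
      by rewrite /kernel (negbTE nda) !mul0r.
    by rewrite !(mul0r,mulr0) addr0.
  rewrite /ball; have [ya|ya] := eqVneq (residue y n) (residue a n).
    by rewrite mulr1n subrr; ring.
  rewrite [G a]kernel_potential 1?eq_sym// mulr0n mulr1n; ring.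
have G0 : zp_mean n G = 0.
  transitivity (zp_mean n (fun a => 1 * G a)).
    by apply: eq_zp_mean => a; rewrite mul1r.
  rewrite /G -(zp_mean_green n v (fun=> 1) kernel_sym).
  rewrite -(zp_mean_cst p_pr n 0); apply: eq_zp_mean => a.
  rewrite -[RHS](mulr0 (v a)); congr (_ * _).
  by rewrite -(zp_mean_cst p_pr n 0); apply: eq_zp_mean => b; rewrite subrr mulr0.
have [_ _ mass _ _] := profile; have := mass n mn => {}mass.
have GB : zp_mean n (fun a => ball n y a * G a) = rho * (1 - M n / nrm y).
  have h : zp_mean n (fun a => - rho * H (fun=> 1) a + ball n y a * G a) = 0.
    rewrite -G0; apply: eq_zp_mean => a; have := GE (fun=> 1) a.
    by rewrite !mul1r => <-.
  move: h; rewrite zp_meanD zp_meanZ.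
  have -> : zp_mean n (H (fun=> 1)) = 1 - M n / nrm y.
    apply: (addIr (M n / nrm y)); rewrite subrK; apply: etrans mass; congr (_ + _).
    by apply: eq_zp_mean => a; rewrite /H mulr1.
  lra.
have -> : zp_mean n (fun a => phi (ofint a) * G a) =
    - rho * zp_mean n (H (phi \o ofint)) + phi (ofint y) * zp_mean n (fun a => ball n y a * G a).
  rewrite -!zp_meanZ -zp_meanD; apply: eq_zp_mean => a.
  rewrite (GE (phi \o ofint)) /=; congr (_ + _).
  rewrite /ball; have [ya|ya] := eqVneq (residue y n) (residue a n).
    by rewrite (phi_level (a := y) _ ya)//; ring.
  by rewrite !(mul0r, mulr0).
rewrite GB; ring.
Qed.

End weak_equation.

Lemma profile_solution : mean_field_solution dx m rho (ofint y) uQ.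
Proof.
have [|[i1 _] [i2 _]] := @uQ_integral m (fun=> 1) (leqnn m); first by [].
split.
- exact: uQ_locally_constant.
- by move: i1; under eq_fun do rewrite mulr1.
- by move: i2; under eq_fun do rewrite mulr1.
- move=> phi lc; have [n mn hn] := locally_constant_level 0 lc.
  exact: weak_mean_field mn hn.
Qed.

End solution.

Theorem theorem4p1 (R : realType) (p : nat) (p_pr : prime p)
    (dx : {measure set (padic p_pr) -> \bar R}) (dx_haar : is_haar dx)
    (m : nat) (m_ge1 : (1 <= m)%N)
    (y : padic p_pr) (yF : fund_domain p p_pr m y)
    (rho : R) (rho_gt0 : 0 < rho)
    (rho_le : rho <= if (2 < p)%N
                     then (p%:R - 2) / p%:R * (1 - p%:R ^- m)
                     else (1 - 2 ^- m) / 4) :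
  exists u : padic p_pr -> R, mean_field_solution dx m rho y u.
Proof.
move: yF; rewrite fund_domainE => -[a am <-].
have [u [A [M prof]]] := mean_field_profile_ex am rho_gt0.
by eexists; exact: (profile_solution dx_haar am prof).
Qed.
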